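(* For every constant $\alpha>1/2$ there exists a sufficiently large constant $K=K(\alpha)$ such that the following holds. Let $G$ be a graph with $n$ vertices and minimum degree at least $\alpha n$, and let $X$ be a uniformly random set of edges of the complete graph $K_n$ on the vertex set $V(G)$, of a given size $|X|$ satisfying $$|X|\geq K n^{4/3}\log^{1/3} n .$$ Then with high probability (as $n\to\infty$) the graph $\Gamma=G+X$ contains the square of a Hamilton cycle.
   Context: All graphs are finite and simple. For a graph $G=(V,E)$ and an edge set (or graph) $X=(V,F)$ on the same vertex set $V$, the graph $G+X$ has vertex set $V$ and edge set $E\cup F$. Identify the vertex set with $[n]=\{1,\dots,n\}$. A graph $H$ on vertex set $[n]$ contains the $k$th power of a Hamilton cycle if there is a bijection $\pi:[n]\to[n]$ such that $\{\pi(i),\pi(j)\}\in E(H)$ whenever $i<j\leq i+k$, with indices taken modulo $n$ (i.e. indices exceeding $n$ are reduced by $n$). The square of a Hamilton cycle is the case $k=2$. ''With high probability'' (w.h.p.) means with probability $1-o(1)$ as $n\to\infty$; the graph $G=G_n$ is arbitrary (deterministic) subject to the minimum degree condition, and the probability is over the random choice of $X$. *)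

(* Defs.v *)
From HB Require Import structures.
From mathcomp Require Import all_boot all_order all_algebra all_fingroup.
From mathcomp Require Import all_classical all_reals all_analysis.

Set Implicit Arguments.
Unset Strict Implicit.
Unset Printing Implicit Defensive.

Import Order.TTheory GRing.Theory Num.Theory.

(** Simple graphs on the vertex set ['I_n] are given by their edge sets, i.e.
    by sets [E \subset complete_graph n] of two-element sets of vertices.  With
    this encoding the graph [G + X] is the union [G :|: X]. *)
Definition complete_graph (n : nat) : {set {set 'I_n}} :=
  [set e : {set 'I_n} | #|e| == 2].

Definition degree (n : nat) (E : {set {set 'I_n}}) (v : 'I_n) : nat :=
  #|[set e in E | v \in e]|.

(** The seed [n] of the iterated minimum is harmless: degrees are smaller than
    [n] in a simple graph on [n] vertices. *)
Definition min_degree (n : nat) (E : {set {set 'I_n}}) : nat :=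
  \big[minn/n]_(v < n) degree E v.

(** Vertices are numbered from [0], and [iota i.+1 k] enumerates the [j] such
    that [i < j <= i + k].  As [j %% n < n], the default value [i] of [insubd]
    is never used. *)
Definition has_ham_cycle_power (k n : nat) (H : {set {set 'I_n}}) : bool :=
  [exists pi : {perm 'I_n}, [forall i : 'I_n,
    all (fun j : nat => [set pi i; pi (insubd i (j %% n)%N)] \in H)
        (iota i.+1 k)]].

Definition edge_sets_of_size (n m : nat) : {set {set {set 'I_n}}} :=
  [set X : {set {set 'I_n}} | X \subset complete_graph n & #|X| == m].

(** Probability of the event [A] for a uniformly random set of [m] edges of the
    complete graph on [n] vertices; meaningful when [m <= 'C(n, 2)]. *)
Definition prob_edge_set (R : realType) (n m : nat)
    (A : pred {set {set 'I_n}}) : R :=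
  (#|[set X in edge_sets_of_size n m | A X]|%:R
    / #|edge_sets_of_size n m|%:R)%R.

(* Main.v *)
Require Import Defs.
From HB Require Import structures.
From mathcomp Require Import all_classical all_reals all_analysis.
From mathcomp Require Import all_boot all_order all_algebra all_fingroup.
From mathcomp Require Import zify ring lra.

Set Implicit Arguments.
Unset Strict Implicit.
Unset Printing Implicit Defensive.

(** The random edges are used through two deterministic consequences of
    randomness, and everything else is extremal graph theory.

    A family of sets of pairs, each of which has at least [n ^ 2 / S] elements,
    is with high probability such that [m] random edges hit all its members, as
    long as it has at most [exp (O (n log n))] members: a given member is missed with
    probability at most [(1 - 1 / S) ^ m], and [m] exceeds [n log n] by a power
    of [n].  So whatever is described by a bounded number of vertex subsets and of
    bounded integer weights on the vertices can serve to ask for a random edge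
    with a prescribed dense property.  Only two kinds of requests are needed:
    pairs of [W] with linearly many common neighbours in [Z]
    ([hits_rich_pairs]), and pairs that are the middle of a slot fitting a
    constant fraction of a weight on the vertices ([hits_slot_pairs]).

    In a square path that alternates disjoint random edges [a1 a2], [b1 b2],
    [c1 c2] and so on, the remaining adjacencies are between consecutive random
    edges, and can be taken in the dense graph.  As every two vertices have
    linearly many common neighbours (degrees exceed [n / 2] by a constant
    fraction of [n]), two ends can always be joined by six vertices
    ([connect_edges]), and any two sets with a positive density of edges between
    them carry such a path of any constant length ([alternating_tile]).

    The square of a Hamilton cycle is then built by absorption.  A path
    [a b c d] absorbs [v], becoming [a b v c d], when [v] is adjacent to all four
    vertices; disjoint slots [a b c d] such that every vertex fits linearly many of
    them are found greedily by a derandomized Chernoff argument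
    ([derandomized_boosting], [absorbers]), and strung into one path.  The same
    argument gives a small reservoir in which all pairs of vertices keep many
    common neighbours ([reservoir]).  A tiling of the rest by paths of constant
    length leaves few vertices, since otherwise it can be enlarged
    ([improve_tiling]).  Finally the tiles and the absorbing path are joined cyclically through the reservoir, and all the vertices still
    missing are absorbed ([absorb_leftover]).

    Throughout, [e] is the dense graph, [xe] the random one, [g] contains both,
    and the inequality [n <= q * #|A|] expresses that [A] has linear size, [q]
    being a constant. *)

(** * Square paths and absorption *)

Section SquarePaths.
Variables (V : eqType) (g : rel V).

(** Consecutive vertices and vertices at distance two are adjacent: each vertex is
    adjacent to the (at most) two that follow. *)
Fixpoint square_path (s : seq V) : bool :=
  if s is x :: s' then all (g x) (take 2 s') && square_path s' else true.

Lemma square_path_catl (s1 s2 : seq V) : square_path (s1 ++ s2) -> square_path s1.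
Proof.
elim: s1 => //= x s1 IH /andP[xs1 /IH ->]; rewrite andbT.
by case: s1 xs1 {IH} => [|y [|z s1]] //=; rewrite ?take0 /= => /andP[->].
Qed.

Lemma square_path_catr (s1 s2 : seq V) : square_path (s1 ++ s2) -> square_path s2.
Proof. by elim: s1 => //= x s1 IH /andP[_ /IH]. Qed.

(** Adjacencies span at most three consecutive vertices, so overlapping in two
    vertices is enough for two square paths to be merged. *)
Lemma square_path_glue (s1 s2 : seq V) x y :
  square_path (s1 ++ [:: x; y]) -> square_path [:: x, y & s2] ->
  square_path (s1 ++ [:: x, y & s2]).
Proof.
elim: s1 => // a s1 IH; rewrite !cat_cons.
move=> /=/andP[as1 /IH{}IH] /IH ->; rewrite andbT.
by case: s1 as1 {IH} => [|b [|c s1]] /=; rewrite ?take0.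
Qed.

Lemma square_path_insert (p q : seq V) a b c d v :
  square_path (p ++ [:: a, b, c, d & q]) -> g a v -> g b v -> g v c -> g v d ->
  square_path (p ++ [:: a, b, v, c, d & q]).
Proof.
move=> sqs av bv vc vd.
have sab : square_path (p ++ [:: a; b]).
  by move: sqs; rewrite -[[:: a, b & _]]/([:: a; b] ++ _) catA => /square_path_catl.
apply: square_path_glue => //; move: sqs => /square_path_catr /=; rewrite !take0 /= !andbT.
by case/and4P=> /andP[-> ac] /andP[bc bd] -> ->; rewrite av bv bc vc vd.
Qed.

Lemma split_last2 (s : seq V) : 1 < size s -> exists s' x y, s = s' ++ [:: x; y].
Proof.
case/lastP: s => // s y; case/lastP: s => // s x _.
by exists s, x, y; rewrite -!cats1 -catA.
Qed.

Lemma split_head2 (s : seq V) : 1 < size s -> exists s' x y, s = [:: x, y & s'].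
Proof. by case: s => [|x [|y s]] // _; exists s, x, y. Qed.

End SquarePaths.

Lemma size_flatten_const (T : Type) l (bs : seq (seq T)) :
  all (fun b => size b == l) bs -> size (flatten bs) = l * size bs.
Proof.
elim: bs => [|b bs IH] /=; first by rewrite muln0.
by case/andP=> /eqP bl /IH; rewrite size_cat bl mulnS => ->.
Qed.

Section Absorption.
Variables (V : eqType) (e g : rel V).
Hypothesis esym : symmetric e.
Hypothesis eg : subrel e g.

Definition absorbable (v : V) (b : seq V) := (size b == 4) && all (e v) b.

(** Greedy absorption: a block that has received a vertex has length five and is
    lost for the others, so every vertex needs as many blocks as there are
    vertices to absorb.  Insertions take place after the second vertex of a
    block, so that the first two vertices [x] and [y], which close the cycle,
    are unchanged. *)
Lemma absorb_leftover (L : seq V) (B : seq (seq V)) x y :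
  take 2 (flatten B) = [:: x; y] -> square_path g (flatten B ++ [:: x; y]) ->
  (forall v, v \in L -> size L <= count (absorbable v) B) ->
  exists s, [/\ perm_eq s (flatten B ++ L), take 2 s = [:: x; y]
              & square_path g (s ++ [:: x; y])].
Proof.
elim: L B => [|v L IH] B hd sqB capB.
  by exists (flatten B); rewrite cats0.
have : has (absorbable v) B by rewrite has_count (leq_trans _ (capB v _)) ?mem_head.
case/hasP => b /splitPr splitB; case: splitB hd sqB capB => B1 B2.
case: b => [|a [|b [|c [|d [|? ?]]]]] //= hd sqB capB.
rewrite /absorbable /= => /and5P[va vb vc vd _].
have [||w wL|s [ps hs ss]] := IH (B1 ++ [:: a; b; v; c; d] :: B2).
- move: hd; rewrite !flatten_cat /=.
  by case: (flatten B1) => [|? [|? ?]] /=; rewrite ?take0.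
- move: sqB; rewrite !flatten_cat /= -!catA /= => sqB.
  by apply: square_path_insert => //; apply: eg => //; rewrite esym.
- have /capB : w \in v :: L by rewrite inE wL orbT.
  by rewrite !count_cat /= -/(absorbable w _); lia.
exists s; split => //; apply: perm_trans ps _.
apply/seq.permP => pr; rewrite !flatten_cat !count_cat /=; lia.
Qed.
End Absorption.

(** * Random edges with many common neighbours *)

Lemma sum_sqr_le (I : finType) (A : {set I}) (f : I -> nat) :
  (\sum_(i in A) f i) ^ 2 <= #|A| * \sum_(i in A) f i ^ 2.
Proof.
have dbl : (\sum_(i in A) f i) ^ 2 * 2 <= #|A| * (\sum_(i in A) f i ^ 2) * 2.
  have -> : #|A| * (\sum_(i in A) f i ^ 2) * 2
      = \sum_(i in A) \sum_(j in A) (f i ^ 2 + f j ^ 2).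
    under [RHS]eq_bigr => i _ do rewrite big_split /= sum_nat_const.
    by rewrite big_split /= sum_nat_const -big_distrr /= muln2 addnn.
  rewrite expnS expn1 big_distrlr /= big_distrl /=.
  apply: leq_sum => i _; rewrite big_distrl /=; apply: leq_sum => j _.
  by have := (nat_Cauchy (f i) (f j)).1; rewrite mulnC.
by rewrite leq_pmul2r in dbl.
Qed.

Lemma card_cond (T : finType) (Z : {set T}) (P : pred T) :
  #|[set z in Z | P z]| = \sum_(z in Z) P z.
Proof. by rewrite -sum1dep_card big_mkcondr; apply: eq_bigr => z _; case: (P z). Qed.

Section Neighbourhoods.
Variables (V : finType) (e : rel V).
Hypothesis esym : symmetric e.
Local Notation n := #|V|.

Definition nbhd (Z : {set V}) x := [set z in Z | e x z].
Definition common_nbhd (Z : {set V}) x y := [set z in Z | e x z && e y z].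

Lemma sum_nbhd (A B : {set V}) :
  \sum_(a in A) #|nbhd B a| = \sum_(b in B) #|nbhd A b|.
Proof.
under eq_bigr => a _ do rewrite card_cond.
rewrite exchange_big /=; apply: eq_bigr => b _; rewrite card_cond.
by apply: eq_bigr => a _; rewrite esym.
Qed.

Lemma sum_common_nbhd (A B Z : {set V}) :
  \sum_(x in A) \sum_(y in B) #|common_nbhd Z x y| = \sum_(z in Z) #|nbhd A z| * #|nbhd B z|.
Proof.
under eq_bigr => x _.
  under eq_bigr => y _ do rewrite card_cond.
  rewrite exchange_big /=; over.
rewrite exchange_big /=; apply: eq_bigr => z _; rewrite !card_cond big_distrlr /=.
by apply: eq_bigr => x _; apply: eq_bigr => y _; rewrite mulnb ![e z _]esym.
Qed.

Lemma common_nbhd_setD (A : {set V}) (s : seq V) x y :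
  #|common_nbhd A x y| <= #|common_nbhd (A :\: [set z in s]) x y| + size s.
Proof.
rewrite -(cardsID [set z in s] (common_nbhd A x y)) addnC leq_add //.
  rewrite subset_leq_card //; apply/subsetP => z; rewrite !inE.
  by case/and3P=> -> -> ->.
by rewrite (leq_trans (subset_leq_card (subsetIr _ _))) // cardsE card_size.
Qed.

Definition rich_pairs (W Z : {set V}) k : {set V * V} :=
  [set p | [&& p.1 \in W, p.2 \in W, p.1 != p.2 & n <= k * #|common_nbhd Z p.1 p.2|]].

(** By Cauchy-Schwarz, the average over [W * W] of the number of common neighbours
    in [Z] is at least [n / r ^ 2] as soon as vertices of [W] have on average
    [n / r] neighbours in [Z].  So a positive proportion of the pairs reach half
    of this average.  The bound on common neighbours does not depend on the size
    [n / p] of [W], which matters for iterating the choice of pairs. *)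
Lemma many_rich_pairs (W Z : {set V}) r p :
  n * #|W| <= r * \sum_(w in W) #|nbhd Z w| -> n <= p * #|W| ->
  4 * r ^ 2 * p ^ 2 <= n ->
  n ^ 2 <= 4 * r ^ 2 * p ^ 2 * #|rich_pairs W Z (2 * r ^ 2)|.
Proof.
move=> dens bigW bign; set F := rich_pairs _ _ _.
set C := \sum_(x in W) \sum_(y in W) #|common_nbhd Z x y|.
have W2C : #|W| ^ 2 * n <= r ^ 2 * C.
  have cs : (\sum_(w in W) #|nbhd Z w|) ^ 2 <= n * C.
    rewrite sum_nbhd /C sum_common_nbhd (leq_trans (sum_sqr_le _ _)) // leq_mul ?max_card //.
  have : (n * #|W|) ^ 2 <= r ^ 2 * (n * C).
    by rewrite (leq_trans (leq_mul dens dens)) // mulnACA leq_mul.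
  case: (posnP n) => [->|n0]; first by rewrite muln0.
  by rewrite -(leq_pmul2l n0); nia.
have CF : 2 * r ^ 2 * C <= 2 * r ^ 2 * n * (#|W| + #|F|) + #|W| ^ 2 * n.
  (* Equal or rich pairs have at most n common neighbours, the others at most
     n / (2 r^2). *)
  have diag : \sum_(p0 in setX W W) (p0.1 == p0.2) = #|W|.
    rewrite -sum1_card (eq_bigl (fun p0 => (p0.1 \in W) && (p0.2 \in W))); last first.
      by case=> x y; exact: in_setX.
    rewrite -(pair_big (mem W) (mem W) (fun x y => nat_of_bool (x == y))) /=.
    apply: eq_bigr => x xW; rewrite (bigD1 x) //= eqxx big1 ?addn0 // => y.
    by case/andP=> _; rewrite eq_sym => /negPf ->.
  have inF : \sum_(p0 in setX W W) (p0 \in F) <= #|F|.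
    by rewrite -(card_cond _ (mem F)) subset_leq_card //; apply/subsetP => p0; rewrite inE => /andP[].
  rewrite /C pair_big /= (eq_bigl (mem (setX W W))) => [|[x y]]; last by rewrite inE in_setX.
  apply: (@leq_trans (\sum_(p0 in setX W W)
      (2 * r ^ 2 * n * ((p0.1 == p0.2) + (p0 \in F)) + n))); last first.
    rewrite big_split /= -big_distrr /= big_split /= diag sum_nat_const cardsX.
    by rewrite leq_add ?leq_mul ?leq_add.
  rewrite big_distrr /=; apply: leq_sum => -[x y] /=; rewrite in_setX /= => /andP[xW yW].
  rewrite inE /= xW yW; case: eqP => _ /=.
    by rewrite muln1 (leq_trans _ (leq_addr _ _)) // leq_mul ?max_card.
  case: (leqP n _) => [_|/ltnW le]; last by rewrite muln0.
  by rewrite (leq_trans _ (leq_addr _ _)) // muln1 leq_mul ?max_card.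
case: (posnP n) => [->//|n0].
have Wn : #|W| <= n by rewrite max_card.
have key : #|W| ^ 2 <= 2 * r ^ 2 * (#|W| + #|F|).
  by rewrite -(leq_pmul2r n0); nia.
have : n ^ 2 <= p ^ 2 * #|W| ^ 2 by rewrite -expnMn leq_exp2r.
nia.
Qed.

Definition hits_rich_pairs (xe : rel V) S := forall (W Z : {set V}) k,
  k <= S -> n ^ 2 <= S * #|rich_pairs W Z k| ->
  exists x y, (x, y) \in rich_pairs W Z k /\ xe x y.

Lemma edge_with_common_nbhd xe S (W Z : {set V}) r p : hits_rich_pairs xe S ->
  n * #|W| <= r * \sum_(w in W) #|nbhd Z w| -> n <= p * #|W| ->
  4 * r ^ 2 * p ^ 2 <= S -> 0 < p -> S <= n ->
  exists x y, [/\ x \in W, y \in W, x != y, xe x y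
                & n <= 2 * r ^ 2 * #|common_nbhd Z x y|].
Proof.
move=> hit dens bigW rpS p0 Sn.
have [||x [y []]] := hit W Z (2 * r ^ 2).
- by rewrite (leq_trans _ rpS); nia.
- by rewrite (leq_trans (many_rich_pairs dens bigW _)) ?leq_mul //; lia.
by rewrite inE /= => /and4P[xW yW xy c] xey; exists x, y.
Qed.
End Neighbourhoods.

(** * Connecting square paths *)

Section Connecting.
Variables (V : finType) (e xe g : rel V) (S q : nat).
Local Notation n := #|V|.
Hypothesis esym : symmetric e.
Hypothesis eirr : irreflexive e.
Hypothesis eg : subrel e g.
Hypothesis xg : subrel xe g.
Hypothesis codeg : forall x y, n <= q * #|common_nbhd e setT x y|.
Hypothesis hit : hits_rich_pairs e xe S.
Hypothesis q0 : 0 < q.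

Lemma dense_of_min_degree (W Z : {set V}) s t :
  (forall z, z \in Z -> n <= s * #|nbhd e W z|) -> n <= t * #|Z| ->
  n * #|W| <= s * t * \sum_(w in W) #|nbhd e Z w|.
Proof.
move=> degZ bigZ; rewrite (sum_nbhd esym) (mulnC s) -mulnA big_distrr /=.
apply: (@leq_trans (t * \sum_(z in Z) n)); last by rewrite leq_mul // leq_sum.
by rewrite sum_nat_const mulnA [leqLHS]mulnC leq_mul // (leq_trans (max_card _)).
Qed.

(** The constants [1 / q1], [1 / q2], [1 / q3] are the densities of the successive
    sets [Z0], [Z1], [Z2] in the proof of [connect_edges]. *)
Definition connect_bound :=
  let q1 := 2 * q ^ 3 in let q2 := 2 * (q1 * q1) ^ 2 in
  let q3 := 2 * (2 * q1 * q2) ^ 2 in 4 * q ^ 2 * q3 ^ 2.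

(** The connection reads [a b x1 x2 z1 z2 y1 y2 c d], where [x1 x2], [z1 z2] and
    [y1 y2] are random edges.  The [x]s are common neighbours of [a] and [b], the
    [y]s of [c] and [d], and the [z]s of the four [x]s and [y]s.  Since any [x] and [y]
    have many common neighbours in [C], many vertices [z] of [C] see a positive
    fraction of both sets of candidates; this set of [z]s is cut down by the choice
    of the [x]s, then of the [y]s, and remains of linear size. *)
Lemma connect_edges (C : {set V}) a b c d : connect_bound <= S -> S <= n ->
  (forall x y, n <= q * #|common_nbhd e C x y|) -> g a b -> g c d ->
  exists k, [/\ size k = 6, uniq k, {subset k <= C} & square_path g ([:: a, b & k] ++ [:: c; d])].
Proof.
rewrite /connect_bound; set q1 := 2 * q ^ 3; set q2 := 2 * (q1 * q1) ^ 2.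
set q3 := 2 * (2 * q1 * q2) ^ 2 => bS Sn codegC ab cd.
have q1E : q1 = 2 * q ^ 3 by []. have q2E : q2 = 2 * (q1 * q1) ^ 2 by [].
have q3E : q3 = 2 * (2 * q1 * q2) ^ 2 by [].
clearbody q1 q2 q3.
have q1_0 : 0 < q1 by rewrite q1E muln_gt0 expn_gt0 q0.
have q2_0 : 0 < q2 by rewrite q2E muln_gt0 expn_gt0 muln_gt0 q1_0.
have q3_0 : 0 < q3 by rewrite q3E muln_gt0 expn_gt0 !muln_gt0 q1_0 q2_0.
have n0 : 0 < n.
  by apply: leq_trans (leq_trans bS Sn); rewrite !muln_gt0 ?expn_gt0 ?q0 ?q3_0.
have q12 : q1 <= 2 * q1 * q2 by move: q2_0; clear; nia.
have q13 : q1 * q1 <= q3.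
  by rewrite q3E -mulnn (leq_trans (leq_mul q12 q12)) // leq_pmull.
have q123 : 2 * (2 * q1 * q2) <= q3.
  by rewrite q3E -mulnn leq_mul // leq_pmulr // (leq_trans q1_0).
have n4 : 4 * q1 <= n.
  apply: leq_trans (leq_trans bS Sn); rewrite -mulnA leq_mul //.
  rewrite (leq_trans (leq_trans (leq_pmulr _ q1_0) q13)) //.
  by rewrite -(mulnn q3) mulnA leq_pmull // muln_gt0 ?expn_gt0 ?q0 ?q3_0.
have q1q : q <= q1 by rewrite q1E expnS mulnCA leq_pmulr // muln_gt0 ?expn_gt0 ?q0.
set W1 := common_nbhd e C a b; set W2 := common_nbhd e C c d.
pose Z0 := [set z in C | (n <= q1 * #|nbhd e W1 z|) && (n <= q1 * #|nbhd e W2 z|)].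
have bigZ0 : n <= q1 * #|Z0|.
  (* Double counting of the triples (x, y, z). *)
  have lo : n ^ 3 <= q ^ 3 * \sum_(z in C) #|nbhd e W1 z| * #|nbhd e W2 z|.
    rewrite -sum_common_nbhd //.
    have : #|W1| * #|W2| * n <= q * \sum_(x in W1) \sum_(y in W2) #|common_nbhd e C x y|.
      rewrite big_distrr -mulnA -sum_nat_const /=; apply: leq_sum => x _.
      by rewrite big_distrr -sum_nat_const /=; apply: leq_sum.
    move=> WWn; apply: (@leq_trans (q ^ 2 * (#|W1| * #|W2| * n))).
      have -> : q ^ 2 * (#|W1| * #|W2| * n) = q * #|W1| * (q * #|W2|) * n.
        by rewrite -mulnn mulnA mulnACA.
      by rewrite !expnS expn0 muln1 mulnA leq_mul // leq_mul ?codegC.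
    by rewrite (expnSr q 2) -[leqRHS]mulnA leq_mul.
  have hi : q1 * \sum_(z in C) #|nbhd e W1 z| * #|nbhd e W2 z| <= q1 * n ^ 2 * #|Z0| + n ^ 3.
    rewrite card_cond !big_distrr /=.
    apply: (@leq_trans (\sum_(z in C) (q1 * n ^ 2 *
        ((n <= q1 * #|nbhd e W1 z|) && (n <= q1 * #|nbhd e W2 z|)) + n ^ 2))).
      apply: leq_sum => z _; have := max_card (mem (nbhd e W1 z)).
      have := max_card (mem (nbhd e W2 z)).
      move: #|nbhd e W1 z| #|nbhd e W2 z| => d1 d2 d2n d1n; rewrite -mulnn.
      case: (leqP n (q1 * d1)) => [_|/ltnW le1] /=; last first.
        by rewrite muln0 mulnA leq_mul.
      case: (leqP n (q1 * d2)) => [_|/ltnW le2] /=; last first.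
        by rewrite muln0 mulnCA leq_mul.
      by rewrite muln1 (leq_trans _ (leq_addr _ _)) // leq_mul // leq_mul.
    by rewrite big_split /= leq_add2l sum_nat_const (expnS n 2) leq_mul ?max_card.
  rewrite -(leq_pmul2l (_ : 0 < n ^ 2)) ?expn_gt0 ?n0 //.
  have q1S T : q1 * T = 2 * (q ^ 3 * T) by rewrite q1E mulnA.
  rewrite q1S in hi; rewrite -expnSr mulnCA mulnA.
  by move: lo hi; move: (q ^ 3 * _) (n ^ 3) (_ * #|Z0|) => A D B; clear; lia.
have W1big : n <= q * #|W1| by exact: codegC.
have [||||x1 [x2 [x1W x2W x12 x12e bigZ1]]] :=
  edge_with_common_nbhd esym hit
    (dense_of_min_degree (s := q1) (t := q1) (Z := Z0) (W := W1) _ bigZ0) W1big.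
- by move=> z; rewrite inE => /and3P[].
- by apply: leq_trans bS; rewrite mulnAC leq_mul // leq_mul // leq_sqr.
- by [].
- by [].
set Z1 := common_nbhd e Z0 x1 x2 in bigZ1; rewrite -q2E in bigZ1.
(* The y must differ from x1 and x2; the z do, being adjacent to them. *)
pose W2' := W2 :\: [set x1; x2].
have W2card (A : {set V}) : #|A :&: W2| <= #|A :&: W2'| + 2.
  rewrite -(cardsID [set x1; x2] (A :&: W2)) addnC leq_add //.
    rewrite subset_leq_card //; apply/subsetP => z; rewrite !inE.
    by case: (z == x1); case: (z == x2); rewrite ?andbF ?andbT.
  by rewrite (leq_trans (subset_leq_card (subsetIr _ _))) // cards2; case: (_ == _).
have degZ1 z : z \in Z1 -> n <= 2 * q1 * #|nbhd e W2' z|.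
  rewrite 2!inE => /andP[/and3P[_ _ zW2] _].
  have := W2card [set y | e z y].
  have nbI A : [set y | e z y] :&: A = nbhd e A z by apply/setP => y; rewrite !inE andbC.
  rewrite !nbI => W2z; rewrite -mulnA; move: zW2 W2z n4; clear; nia.
have W2big : n <= 2 * q * #|W2'|.
  have := W2card setT; rewrite !setTI => W2z.
  have := codegC c d; rewrite -/W2 -mulnA; move: W2z n4 q1q; clear; nia.
have [|||y1 [y2 [y1W y2W y12 y12e bigZ2]]] :=
  edge_with_common_nbhd esym hit (dense_of_min_degree degZ1 bigZ1) W2big.
- apply: leq_trans bS.
  have -> : 4 * (2 * q1 * q2) ^ 2 * (2 * q) ^ 2 = 4 * q ^ 2 * (2 * (2 * q1 * q2)) ^ 2.
    by clear; rewrite -!mulnn; lia.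
  by rewrite leq_mul // leq_sqr.
- by rewrite muln_gt0.
- by [].
(* For z1 z2 no property but membership in Z2 is wanted: the common
   neighbourhood in the whole vertex set is always large. *)
set Z2 := common_nbhd e Z1 y1 y2 in bigZ2; rewrite -q3E in bigZ2.
have [||||z1 [z2 [z1Z z2Z z12 z12e _]]] :=
  @edge_with_common_nbhd V e esym xe S Z2 setT q q3 hit _ bigZ2.
- rewrite mulnC -sum_nat_const big_distrr /=; apply: leq_sum => z _.
  apply: leq_trans (codeg z z) _; rewrite leq_mul // subset_leq_card //.
  by apply/subsetP => y; rewrite !inE /= andbb.
- exact: bS.
- by [].
- by [].
exists [:: x1; x2; z1; z2; y1; y2].
have neq u v : e u v -> ((u == v) = false) * ((v == u) = false).
  move=> uv; have uNv : (u == v) = false by apply: contraTF uv => /eqP ->; rewrite eirr.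
  by split=> //; rewrite eq_sym.
move: x1W x2W y1W y2W z1Z z2Z; rewrite /W2' !inE !negb_or -!andbA.
move=> /and3P[x1C ax1 bx1] /and3P[x2C ax2 bx2].
move=> /and5P[y11 y12' y1C cy1 dy1] /and5P[y21 y22 y2C cy2 dy2].
move=> /and5P[z1C _ _ x1z1 /and3P[x2z1 y1z1 y2z1]].
move=> /and5P[z2C _ _ x1z2 /and3P[x2z2 y1z2 y2z2]].
split => //=.
- rewrite !inE (negPf x12) (negPf y12) (negPf z12) !(eq_sym _ y1) !(eq_sym _ y2).
  rewrite (negPf y11) (negPf y12') (negPf y21) (negPf y22).
  rewrite ?(neq _ _ x1z1, neq _ _ x1z2, neq _ _ x2z1, neq _ _ x2z2).
  by rewrite ?(neq _ _ y1z1, neq _ _ y1z2, neq _ _ y2z1, neq _ _ y2z2).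
- move=> u; rewrite !inE => /or4P[/eqP->|/eqP->|/eqP->|/or3P[] /eqP->] //.
have eg' u v : e u v -> g v u by rewrite esym => /eg.
rewrite ab cd (eg ax1) (eg bx1) (eg bx2) (xg x12e) (eg x1z1).
rewrite (eg x2z1) (eg x2z2) (xg z12e) (eg' _ _ y1z1) (eg' _ _ y1z2).
by rewrite (eg' _ _ y2z2) (xg y12e) (eg' _ _ cy1) (eg' _ _ cy2) (eg' _ _ dy2).
Qed.

Lemma square_path_last_edge (s : seq V) a b : square_path g (s ++ [:: a; b]) -> g a b.
Proof. by move/square_path_catr => /=; rewrite !andbT. Qed.

Lemma square_path_first_edge (s : seq V) a b : square_path g [:: a, b & s] -> g a b.
Proof. by move=> /= /andP[/andP[]]. Qed.

(** The connectors [ks] come out separately from the arrangement [B] of connectors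
    and paths, because only the order of [B] matters for adjacency and only its
    content for disjointness.  The end [c d] is meant to be the beginning of [p0],
    which closes a cycle. *)
Lemma chain_paths (ps : seq (seq V)) (C : {set V}) p0 c d :
  connect_bound <= S -> S <= n ->
  (forall x y, n + q * (6 * size ps) <= q * #|common_nbhd e C x y|) ->
  all (fun p => (1 < size p) && square_path g p) ps ->
  1 < size p0 -> square_path g p0 -> g c d ->
  exists ks B, [/\ size ks = (size ps).+1, all (fun k => size k == 6) ks,
    uniq (flatten ks), {subset flatten ks <= C} &
    perm_eq B (ks ++ ps) /\ square_path g (p0 ++ flatten B ++ [:: c; d])].
Proof.
move=> bS Sn; elim: ps C p0 => [|p ps IH] C p0 codegC ps_ok p0_big sqp0 cd.
  have [s [a [b p0E]]] := split_last2 p0_big; rewrite p0E in sqp0 *.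
  have [|k [k6 ku kC sqk]] := @connect_edges C a b c d bS Sn _ (square_path_last_edge sqp0) cd.
    by move=> x y; apply: leq_trans (codegC x y); rewrite leq_addr.
  exists [:: k], [:: k]; rewrite /= !cats0 k6 perm_refl; split => //; split => //.
  by rewrite -!catA; apply: square_path_glue.
move: ps_ok => /= /andP[/andP[p_big sqp] ps_ok].
have [s [a [b p0E]]] := split_last2 p0_big; rewrite p0E in sqp0 *.
have [s' [c' [d' pE]]] := split_head2 p_big; rewrite pE in sqp *.
have [|k [k6 ku kC sqk]] := @connect_edges C a b c' d' bS Sn _
    (square_path_last_edge sqp0) (square_path_first_edge sqp).
  by move=> x y; apply: leq_trans (codegC x y); rewrite leq_addr.
have sqp1 : square_path g ((s ++ [:: a; b]) ++ k ++ [:: c', d' & s']).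
  rewrite -catA; apply: square_path_glue => //.
  by rewrite -[_ :: _]/(([:: a, b & k]) ++ [:: c', d' & s']); apply: square_path_glue.
have [||ks [B [szks ks6 uks ksC [pB sqB]]]] := IH (C :\: [set x in k]) _ _ ps_ok _ sqp1 cd.
- move=> x y; have := codegC x y.
  have := common_nbhd_setD e C k x y; rewrite k6.
  move=> /(leq_mul (leqnn q)); rewrite mulnDr => le1 /leq_trans/(_ le1) /=.
  by rewrite mulnS mulnDr addnCA addnC leq_add2r.
- by rewrite !size_cat /= k6; lia.
exists (k :: ks), (k :: [:: c', d' & s'] :: B); split => //=.
- by rewrite szks.
- by rewrite k6.
- rewrite cat_uniq ku uks andbT; apply/hasPn => z /ksC; rewrite !inE.
  by case/andP.
- by move=> z; rewrite mem_cat => /orP[/kC//|/ksC]; rewrite inE => /andP[].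
split; last by move: sqB; rewrite -!catA /= -!catA.
by rewrite perm_cons -(cat1s [:: c', d' & s'] ps) perm_sym perm_catCA perm_cons perm_sym.
Qed.
End Connecting.

(** * Tiles in dense pairs of sets *)

Section Tiles.
Variables (V : finType) (e xe g : rel V) (S : nat).
Local Notation n := #|V|.
Hypothesis esym : symmetric e.
Hypothesis eg : subrel e g.
Hypothesis xg : subrel xe g.
Hypothesis hit : hits_rich_pairs e xe S.

(** The classical subgraph of large minimum degree.  Instead of deleting vertices
    one by one, take the subsets that maximize the number of edges minus
    [n / (4 q)] times the number of vertices: no vertex of small degree can be
    left, as removing it would increase this quantity. *)
Lemma dense_core (A B : {set V}) q : 0 < n ->
  n ^ 2 <= q * \sum_(a in A) #|nbhd e B a| ->
  exists A1 B1 : {set V}, [/\ A1 \subset A, B1 \subset B, A1 != set0,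
    forall a, a \in A1 -> n <= 4 * q * #|nbhd e B1 a| &
    forall b, b \in B1 -> n <= 4 * q * #|nbhd e A1 b|].
Proof.
move=> n0 dens.
pose E (P : {set V} * {set V}) := 4 * q * \sum_(a in P.1) #|nbhd e P.2 a|.
pose c (P : {set V} * {set V}) := n * (#|P.1| + #|P.2|).
pose ok (P : {set V} * {set V}) := (P.1 \subset A) && (P.2 \subset B).
have okAB : ok (A, B) by rewrite /ok /= !subxx.
(* M is added to stay within natural numbers. *)
pose M := 2 * n ^ 2.
have cM P : c P <= M by rewrite /c /M mul2n -addnn mulnDr leq_add // -mulnn leq_mul ?max_card.
case: (@arg_maxnP _ (A, B) ok (fun P => E P + M - c P) okAB) => -[A1 B1].
rewrite /ok /= => /andP[A1A B1B] maxP.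
have maxE (A2 B2 : {set V}) : A2 \subset A1 -> B2 \subset B1 ->
    E (A2, B2) + c (A1, B1) <= E (A1, B1) + c (A2, B2).
  move=> A2A B2B; have := maxP (A2, B2); rewrite (subset_trans A2A) ?(subset_trans B2B) //=.
  move=> /(_ isT); have := cM (A1, B1); have := cM (A2, B2).
  move: (E (A2, B2)) (E (A1, B1)) (c (A2, B2)) (c (A1, B1)) (M) => ? ? ? ? ?; clear; lia.
have Epos : c (A1, B1) < E (A1, B1).
  have := maxP (A, B) okAB; have := cM (A, B); have := cM (A1, B1).
  have : 4 * n ^ 2 <= E (A, B) by rewrite /E /= -mulnA leq_mul.
  have : 0 < n ^ 2 by rewrite expn_gt0 n0.
  have : c (A, B) <= 2 * n ^ 2 by exact: cM.
  rewrite /M; move: (E (A, B)) (E (A1, B1)) (c (A, B)) (c (A1, B1)) (n ^ 2) => ? ? ? ? ?; clear; lia.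
exists A1, B1; split => //.
- apply: contraTneq Epos => ->; rewrite /E /= big_set0 muln0 //.
- move=> a aA; have := maxE (A1 :\ a) B1 (subsetDl _ _) (subxx _).
  rewrite /E /c /= [X in _ <= _ * X + _](big_setD1 a aA) /=.
  rewrite (cardsD1 a A1) aA !mulnDr; lia.
move=> b bB; have := maxE A1 (B1 :\ b) (subxx _) (subsetDl _ _).
rewrite /E /c /= (sum_nbhd esym A1 (B1 :\ b)) (sum_nbhd esym A1 B1).
rewrite [X in _ <= _ * X + _](big_setD1 b bB) /=.
rewrite (cardsD1 b B1) bB !mulnDr; lia.
Qed.

(** One step in the construction of a tile: [x y] is the last random edge, and
    [u] the path built so far.  The vertices [a1] and [a2] have again
    [n / (2 r ^ 2)] common neighbours on the other side, the same bound as [x]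
    and [y], so that the step can be repeated without loss. *)
Lemma extend_by_edge (A B : {set V}) r x y (u : seq V) :
  (forall a, a \in A -> n <= r * #|nbhd e B a|) ->
  n <= 2 * r ^ 2 * #|common_nbhd e A x y| -> 4 * r ^ 2 * size u <= n ->
  4 * r ^ 2 * (4 * r ^ 2) ^ 2 <= S -> 0 < r -> S <= n ->
  exists a1 a2, [/\ a1 \in A, a2 \in A, a1 \notin u, a2 \notin u &
   [/\ a1 != a2, square_path g [:: a1; a2], (g x y -> square_path g [:: x; y; a1; a2]) &
    n <= 2 * r ^ 2 * #|common_nbhd e B a1 a2| ]].
Proof.
move=> degA big su rS r0 Sn.
pose W := common_nbhd e A x y :\: [set z in u].
have WA w : w \in W -> w \in A by rewrite !inE => /and3P[].
have cardW : #|common_nbhd e A x y| <= #|W| + size u.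
  rewrite -(cardsID [set z in u] (common_nbhd e A x y)) addnC leq_add //.
  by rewrite (leq_trans (subset_leq_card (subsetIr _ _))) // cardsE card_size.
have bigW : n <= 4 * r ^ 2 * #|W|.
  by move: (leq_mul (leqnn (2 * r ^ 2)) cardW); rewrite mulnDr; lia.
have [||||a1 [a2 [a1W a2W a12 xa12 cod]]] := edge_with_common_nbhd (r := r) (Z := B) esym hit _ bigW.
- rewrite mulnC -sum_nat_const big_distrr /=; apply: leq_sum => w wW.
  exact/degA/WA.
- by [].
- by rewrite !muln_gt0 ?expn_gt0 r0.
- by [].
exists a1, a2; move: (a1W) (a2W); rewrite !inE.
move=> /and4P[a1u _ xa1 ya1] /and4P[a2u _ xa2 ya2].
split; rewrite ?WA //; split => //; first by rewrite /= (xg xa12).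
by move=> /= ->; rewrite (eg xa1) (eg ya1) (eg ya2) (xg xa12).
Qed.

Definition alternating_tile_bound q := let r := 4 * q in 4 * r ^ 2 * (4 * r ^ 2) ^ 2.

(** The path starts with a random edge in [B] and then takes [t] times a random
    edge in [A] followed by one in [B].  For disjoint [A] and [B] it thus uses
    slightly less than half of its vertices in [A]. *)
Lemma alternating_tile (A B : {set V}) q t : 0 < q -> alternating_tile_bound q <= S -> S <= n ->
  4 * (4 * q) ^ 2 * (4 * t + 6) <= n ->
  n ^ 2 <= q * \sum_(a in A) #|nbhd e B a| ->
  exists s sa sb, [/\ uniq s /\ square_path g s, perm_eq s (sa ++ sb),
    {subset sa <= A}, {subset sb <= B} & size sa = 2 * t /\ size sb = 2 * t + 2].
Proof.
rewrite /alternating_tile_bound; set r := 4 * q => q0 bS Sn tn dens.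
have r0 : 0 < r by rewrite muln_gt0.
have n0 : 0 < n by apply: leq_trans tn; rewrite !muln_gt0 ?expn_gt0 ?addn_gt0 ?orbT ?r0 ?q0.
have [A1 [B1 [A1A B1B A10 degA degB]]] := dense_core n0 dens.
rewrite -/r in degA degB.
have step A' B' x y u h1 h2 h3 := @extend_by_edge A' B' r x y u h1 h2 h3 bS r0 Sn.
suff [s [sa [sb [x [y [[us sqs pes saA sbB] [za zb] bigxy]]]]]] : exists s sa sb x y,
  [/\ [/\ uniq (s ++ [:: x; y]), square_path g (s ++ [:: x; y]), perm_eq (s ++ [:: x; y]) (sa ++ sb),
    {subset sa <= A1} & {subset sb <= B1}], size sa = 2 * t /\ size sb = 2 * t + 2 &
    n <= 2 * r ^ 2 * #|common_nbhd e A1 x y|].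
  exists (s ++ [:: x; y]), sa, sb; split => //.
    by move=> z /saA; apply/subsetP.
  by move=> z /sbB; apply/subsetP.
elim: t tn => [|t IH] tn.
  have [a aA] := set0Pn _ A10.
  have [||b1 [b2 [b1B b2B _ _ [b12 sqb _ big]]]] := step B1 A1 a a [::] degB.
  - apply: leq_trans (degA a aA) _; rewrite leq_mul //.
      by rewrite -mulnn mulnA leq_pmull // muln_gt0.
    by rewrite subset_leq_card //; apply/subsetP => z; rewrite !inE => /andP[-> ->].
  - by rewrite muln0.
  exists [::], [::], [:: b1; b2], b1, b2; split => //; split => //=.
  - by rewrite inE b12.
  - by move=> z; rewrite !inE => /orP[] /eqP ->.
have [|s [sa [sb [x [y [[us sqs pes saA sbB] [za zb] bigxy]]]]]] := IH.
  by apply: leq_trans tn; rewrite leq_mul //; lia.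
have szs : size (s ++ [:: x; y]) = 4 * t + 2 by rewrite (perm_size pes) size_cat za zb; lia.
have [|a1 [a2 [a1A a2A a1s a2s [a12 sqa sqxa biga]]]] := step A1 B1 x y (s ++ [:: x; y]) degA bigxy.
  apply: leq_trans tn; rewrite szs leq_mul2l; apply/orP; right.
  by rewrite mulnS; clear; lia.
have [|b1 [b2 [b1B b2B b1s b2s [b12 sqb sqab bigb]]]] :=
   step B1 A1 a1 a2 ((s ++ [:: x; y]) ++ [:: a1; a2]) degB biga.
  apply: leq_trans tn; rewrite size_cat szs leq_mul2l; apply/orP; right.
  by rewrite /= mulnS; clear; lia.
have gxy : g x y by move: sqs => /square_path_catr /=; rewrite !andbT.
have gaa : g a1 a2 by move: sqa => /=; rewrite !andbT.
have sqT : square_path g ((s ++ [:: x; y]) ++ [:: a1; a2]).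
  by rewrite -catA; apply: square_path_glue => //; apply: sqxa.
exists ((s ++ [:: x; y]) ++ [:: a1; a2]), (sa ++ [:: a1; a2]), (sb ++ [:: b1; b2]), b1, b2.
split => //.
- split.
  + rewrite 2!cat_uniq us /= !negb_or b1s b2s a1s a2s /= ?inE ?orbF ?andbT.
    by rewrite a12 b12.
  + by rewrite -catA; apply: square_path_glue => //; apply: sqab.
  + apply/seq.permP => pr; move/seq.permP: pes => /(_ pr).
    by rewrite !count_cat => cnt; rewrite [RHS]addnACA -cnt addnA.
  + by move=> z; rewrite mem_cat !inE => /or3P[/saA|/eqP->|/eqP->].
  + by move=> z; rewrite mem_cat !inE => /or3P[/sbB|/eqP->|/eqP->].
- by rewrite !size_cat za zb /=; clear; lia.
Qed.
End Tiles.

(** * Derandomized choice of absorbers and reservoir *)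

Lemma bernoulli a m : a ^ m.+1 + m.+1 * a ^ m <= a.+1 ^ m.+1.
Proof.
elim: m => [|m IH]; first by rewrite !expn1 expn0 muln1 addn1.
rewrite (expnS a.+1) mulSn.
apply: leq_trans (leq_add IH (leq_mul (leqnn a) IH)).
rewrite mulnDr -expnS mulnCA -expnS.
by rewrite [leqRHS]addnC -addnA leq_add2l mulSn addnC leq_add2l leq_addr.
Qed.

Lemma exp_pred_half K u : 0 < K -> (2 * K).-1 ^ (2 * K * u) * 2 ^ u <= (2 * K) ^ (2 * K * u).
Proof.
move=> K0; rewrite !(expnM _ (2 * K)) -expnMn; case: u => // u; rewrite leq_exp2r //.
have -> : 2 * K = (2 * K).-1.+1 by rewrite prednK // muln_gt0.
move: (2 * K).-1 => a /=; apply: leq_trans (bernoulli a a).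
by rewrite muln2 -addnn leq_add2l expnS leq_mul.
Qed.

Lemma averaging (O : finType) (B : {set O}) (F : O -> nat) K m N :
  0 < #|B| <= N -> N * m <= K * \sum_(o in B) F o -> exists2 o, o \in B & m <= K * F o.
Proof.
case/andP=> B0 BN le.
case: (pickP [pred o in B | m <= K * F o]) => [i /andP[iB mi]|none]; first by exists i.
have /leq_trans/(_ le) : \sum_(o in B) (K * F o + 1) <= N * m.
  apply: (@leq_trans (\sum_(o in B) m)); last by rewrite sum_nat_const leq_mul.
  by apply: leq_sum => o oB; rewrite addn1 ltnNge; have := none o; rewrite /= oB /= => ->.
by rewrite big_split /= -big_distrr /= sum1_card -[leqRHS]addn0 leq_add2l leqNgt B0.
Qed.

(** Method of conditional expectations.  If for all weights on the tests [i] some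
    admissible option [o] fits a fraction [1 / K] of the weight, options can be
    chosen one after the other so that every test is fitted many times.  Halving
    the weight of a test each time it is fitted makes the total weight decrease by
    a factor [1 - 1 / (2 K)] per step, whereas a test that is rarely fitted keeps
    a large weight.  Weights are multiplied by [2 ^ M] in order to be integers. *)
Lemma derandomized_boosting (I : finType) (O : Type) (fit : I -> O -> bool)
    (P : seq O -> Prop) K u M :
  0 < K -> 2 * K * u <= M -> P [::] ->
  (forall s, P s -> size s < 2 * K * u -> exists2 o, P (o :: s) &
     \sum_i 2 ^ (M - count (fit i) s) <=
     K * \sum_(i | fit i o) 2 ^ (M - count (fit i) s)) ->
  exists s, [/\ P s, size s = 2 * K * u &
     forall i, 2 ^ u <= #|I| * 2 ^ count (fit i) s].
Proof.
move=> K0 uM P0 step.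
pose Phi s := \sum_i 2 ^ (M - count (fit i) s).
have [s [Ps szs le]] : exists s, [/\ P s, size s = 2 * K * u &
    (2 * K) ^ (2 * K * u) * Phi s <= (2 * K).-1 ^ (2 * K * u) * (#|I| * 2 ^ M)].
  move: {1 3 4 5}(2 * K * u) (leqnn (2 * K * u)) => T; elim: T => [|T IH] TK.
    exists [::]; split => //; rewrite !expn0 !mul1n /Phi.
    by under eq_bigr => i _ do rewrite /= subn0; rewrite sum_nat_const.
  have [s [Ps szs le]] := IH (ltnW TK).
  have [|o Po big] := step s Ps; first by rewrite szs.
  exists (o :: s); split => //=; first by rewrite szs.
  have Phi2 : 2 * Phi (o :: s) + \sum_(i | fit i o) 2 ^ (M - count (fit i) s) = 2 * Phi s.
    rewrite /Phi big_distrr [in RHS]big_distrr /= [X in _ + X = _]big_mkcond -big_split /=.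
    apply: eq_bigr => i _; case: (fit i o); last by rewrite add0n addn0.
    have : count (fit i) s < M.
      by apply: leq_ltn_trans (count_size _ _) _; rewrite szs (leq_trans TK).
    by move=> lt; rewrite add1n -expnS subnSK // mul2n addnn.
  have Phi1 : 2 * K * Phi (o :: s) <= (2 * K).-1 * Phi s.
    rewrite -(leq_add2r (Phi s)) -mulSnr prednK ?muln_gt0 ?K0 //.
    by rewrite !(mulnC 2 K) -!mulnA -Phi2 mulnDr leq_add2l.
  rewrite expnSr -[leqLHS]mulnA (leq_trans (leq_mul (leqnn _) Phi1)) //.
  by rewrite (expnS (2 * K).-1) mulnCA -[leqRHS]mulnA leq_mul.
exists s; split => // i.
have a0 : 0 < (2 * K).-1 by case: (K) K0 => // k _; rewrite mulnS.
have c0 : count (fit i) s <= M by rewrite (leq_trans (count_size _ _)) ?szs.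
rewrite -(leq_pmul2l (_ : 0 < (2 * K).-1 ^ (2 * K * u))) ?expn_gt0 ?a0 //.
apply: leq_trans (exp_pred_half u K0) _.
rewrite -(leq_pmul2r (_ : 0 < 2 ^ (M - count (fit i) s))) ?expn_gt0 //.
apply: leq_trans (leq_trans _ le) _.
  by rewrite leq_mul // /Phi (bigD1 i) //= leq_addr.
by rewrite -!mulnA leq_mul // leq_mul // -expnD subnKC.
Qed.

Section Boosted.
Variables (V : finType) (e xe g : rel V) (S : nat).
Local Notation n := #|V|.
Hypothesis esym : symmetric e.
Hypothesis eirr : irreflexive e.
Hypothesis eg : subrel e g.
Hypothesis xg : subrel xe g.

(** The tests are the pairs of vertices, and the options fitting a pair are its
    common neighbours. *)
Lemma reservoir (A : {set V}) q u : 0 < n -> 0 < q ->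
  (forall x y, n <= q * #|common_nbhd e A x y|) -> 2 * q * (2 * (2 * q) * u) <= n ->
  exists s, [/\ uniq s, {subset s <= A}, size s = 2 * (2 * q) * u &
    forall x y, 2 ^ u <= n ^ 2 * 2 ^ #|common_nbhd e [set z in s] x y| ].
Proof.
move=> n0 q0 codegA un.
have [||||s [[us sA] szs boost]] := @derandomized_boosting (V * V)%type V
  (fun p o => e p.1 o && e p.2 o) (fun s => uniq s /\ {subset s <= A})
  (2 * q) u (2 * (2 * q) * u); rewrite ?muln_gt0 //.
  move=> s [us sA] szs.
  pose w (p : V * V) :=
    2 ^ (2 * (2 * q) * u - count (fun o => e p.1 o && e p.2 o) s).
  rewrite -/w.
  pose B := A :\: [set z in s].
  have codegB x y : n <= 2 * q * #|common_nbhd e B x y|.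
    have := leq_mul (leqnn (2 * q)) (common_nbhd_setD e A s x y); rewrite mulnDr.
    have := leq_trans (leq_mul (leqnn (2 * q)) (ltnW szs)) un; have := codegA x y.
    rewrite -/B -(mulnA 2 q #|common_nbhd e A x y|).
    move: (q * #|common_nbhd e A x y|) (2 * q * size s) (2 * q * #|_|) => a b c; clear; lia.
  have [x _] : exists x : V, x \in V by apply/card_gt0P.
  have B0 : 0 < #|B|.
    have : 0 < #|common_nbhd e B x x| by have := codegB x x; case: #|common_nbhd _ _ _ _|; lia.
    by move/leq_trans; apply; rewrite subset_leq_card //; apply/subsetP=> z; rewrite inE => /andP[].
  have [||o oB le] := @averaging V B
      (fun o => \sum_(p | e p.1 o && e p.2 o) w p) (2 * q) (\sum_p w p) n.
  - by rewrite B0 max_card.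
  - rewrite (exchange_big_dep predT) //= !big_distrr /=; apply: leq_sum => -[y z] _ /=.
    rewrite sum_nat_const mulnA leq_mul // (leq_trans (codegB y z)) // leq_mul //.
    by rewrite subset_leq_card //; apply/subsetP => o; rewrite [in X in X -> _]inE unfold_in.
  exists o => //; split.
    by rewrite /= us andbT; move: oB; rewrite !inE => /andP[].
  move=> z; rewrite inE => /orP[/eqP ->|/sA//].
  by move: oB; rewrite !inE => /andP[].
exists s; split => // x y; have := boost (x, y).
rewrite card_prod mulnn => /leq_trans -> //; rewrite leq_mul // leq_exp2l //=.
rewrite -size_filter -(card_uniqP (filter_uniq _ us)) subset_leq_card //.
by apply/subsetP => z; rewrite mem_filter !inE andbC.
Qed.

(** A pair [P] is the middle [b c] and a pair [R] the outer part [a d] of a future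
    block [a b c d]; the adjacencies of [a] and [d] to [b] and [c] are in the
    dense graph, and [b c] will be a random edge. *)
Definition slot (U : {set V}) (P R : V * V) :=
  [&& P.1 \in U, P.2 \in U, R.1 \in U & R.2 \in U] &&
  [&& P.1 != P.2, R.1 != R.2, e R.1 P.1, e R.1 P.2, e R.2 P.1 & e R.2 P.2].
Definition slot_absorbable v (P R : V * V) := [&& e v P.1, e v P.2, e v R.1 & e v R.2].

Definition slot_pairs (U : {set V}) (w : V -> nat) k : {set V * V} :=
  [set P | [exists R, slot U P R &&
     (\sum_v w v <= k * \sum_(v | slot_absorbable v P R) w v)]].

Lemma sum_diag : \sum_(p : V * V) (p.1 == p.2) = n.
Proof.
rewrite -(pair_big predT predT (fun x y : V => nat_of_bool (x == y))) /=.
rewrite -sum1_card; apply: eq_bigr => x _; rewrite (bigD1 x) //= eqxx big1 // => y.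
by rewrite eq_sym => /negPf ->.
Qed.

(** Inside the neighbourhood [W] of [v], the pairs [R] that complete [P] are those of
    common neighbours of [P.1] and [P.2].  Counting them amounts to a lower bound on
    the second moment of the number of common neighbours, hence to two
    applications of the Cauchy-Schwarz inequality.  Degenerate pairs account for
    the term of order [n ^ 3]. *)
Lemma many_slots (U : {set V}) p v : 4 * p ^ 6 <= n -> 0 < p ->
  (forall x y, n <= p * #|common_nbhd e U x y|) ->
  n ^ 4 <= 2 * p ^ 6 * \sum_P \sum_R (slot U P R && slot_absorbable v P R).
Proof.
move=> bign p0 codegU; set Q := \sum_P _.
have n0 : 0 < n by apply: leq_trans bign; rewrite muln_gt0 expn_gt0 p0.
pose W := nbhd e U v.
have degW z : n <= p * #|nbhd e W z|.
  apply: leq_trans (codegU v z) _; rewrite leq_mul // subset_leq_card //.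
  by apply/subsetP => y; rewrite !inE -andbA.
have bigW : n <= p * #|W|.
  apply: leq_trans (degW v) _; rewrite leq_mul // subset_leq_card //.
  by apply/subsetP => y; rewrite inE => /andP[].
pose C P := #|common_nbhd e W P.1 P.2|.
have C1 : n ^ 3 <= p ^ 3 * \sum_(P in setX W W) C P.
  have -> : \sum_(P in setX W W) C P = \sum_(z in W) #|nbhd e W z| ^ 2.
    under [RHS]eq_bigr => z _ do rewrite -mulnn.
    rewrite -(sum_common_nbhd esym) pair_big /=.
    by apply: eq_bigl => -[x y]; rewrite in_setX.
  apply: (@leq_trans (p * #|W| * n ^ 2)).
    by rewrite expnS leq_mul.
  rewrite (mulnC p) -mulnA -sum_nat_const big_distrr /=; apply: leq_sum => z _.
  by rewrite (expnS p 2) -mulnA leq_mul // -expnMn leq_sqr.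
have C2 : n ^ 4 <= p ^ 6 * \sum_(P in setX W W) C P ^ 2.
  have := sum_sqr_le (setX W W) C; set A := \sum_(P in _) C P; set B := \sum_(P in _) _.
  move=> AB; have : (n ^ 3) ^ 2 <= p ^ 6 * (n ^ 2 * B).
    apply: leq_trans (leq_mul C1 C1) _; rewrite mulnACA -expnD leq_mul //.
    by apply: leq_trans AB _; rewrite leq_mul // cardsX -mulnn leq_mul ?max_card.
  by rewrite -expnM (expnD n 2 4) mulnCA leq_pmul2l // expn_gt0 n0.
have C3 : \sum_(P in setX W W) C P ^ 2 <= Q + 2 * n ^ 3.
  have -> : 2 * n ^ 3 = \sum_(P : V * V) \sum_(R : V * V) ((P.1 == P.2) + (R.1 == R.2)).
    under eq_bigr => P _ do rewrite big_split /= sum_diag sum_nat_const card_prod.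
    rewrite big_split /= -big_distrr /= sum_diag sum_nat_const card_prod mul2n -addnn.
    by rewrite !expnS expn0 muln1 !mulnA.
  rewrite /Q -big_split big_mkcond /=; apply: leq_sum => P _.
  case: ifP => // PW; rewrite -mulnn -cardsX -sum1_card big_mkcond -big_split /=.
  apply: leq_sum => R _; move: PW; case: P R => [b c] [a d].
  rewrite !in_setX !inE /=.
  case: ifP => // /andP[/andP[/andP[aU va] /andP[ba ca]] /andP[/andP[dU vd] /andP[bd cd]]].
  case/andP=> /andP[bU vb] /andP[cU vc].
  rewrite /slot /slot_absorbable /= aU bU cU dU va vb vc vd !(esym a) !(esym d) ba bd ca cd.
  by case: (b == c); case: (a == d).
have : 2 * p ^ 6 * (2 * n ^ 3) <= n ^ 4.
  by rewrite mulnACA mulnA (expnS n) leq_mul // mulnC mulnA.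
move: C2 => /leq_trans/(_ (leq_mul (leqnn _) C3)); rewrite mulnDr.
move: (p ^ 6) (n ^ 4) (2 * n ^ 3) (Q) => A B D Q'; clear; lia.
Qed.

(** Averaging [many_slots] over [v] with weights [w]: a positive proportion of the
    pairs [P] is the middle of a slot that fits a positive proportion of the
    weight. *)
Lemma many_slot_pairs (U : {set V}) w p : 4 * p ^ 6 <= n -> 0 < p ->
  (forall x y, n <= p * #|common_nbhd e U x y|) -> 0 < \sum_v w v ->
  n ^ 2 <= 4 * p ^ 6 * #|slot_pairs U w (4 * p ^ 6)|.
Proof.
move=> bign p0 codegU; set k := 4 * p ^ 6; set F := slot_pairs _ _ _.
have k2 : k = 2 * (2 * p ^ 6) by rewrite mulnA.
set W := \sum_v w v => W0.
have n0 : 0 < n by apply: leq_trans bign; rewrite muln_gt0 expn_gt0 p0.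
pose T P R := \sum_(v | slot U P R && slot_absorbable v P R) w v.
have lo : 2 * n ^ 4 * W <= k * \sum_P \sum_R T P R.
  have -> : \sum_P \sum_R T P R = \sum_v w v * \sum_P \sum_R (slot U P R && slot_absorbable v P R).
    rewrite /T; under [RHS]eq_bigr => v _ do rewrite big_distrr /=.
    rewrite [RHS]exchange_big /=; apply: eq_bigr => P _.
    under [RHS]eq_bigr => v _ do rewrite big_distrr /=.
    rewrite [RHS]exchange_big /=; apply: eq_bigr => R _; rewrite big_mkcond /=.
    by apply: eq_bigr => v _; case: (_ && _); rewrite ?muln1 ?muln0.
  rewrite /W !big_distrr /=; apply: leq_sum => v _.
  by rewrite [leqLHS]mulnC [leqRHS]mulnCA leq_mul // k2 -mulnA leq_mul // many_slots.
have hi : k * \sum_P \sum_R T P R <= (n ^ 4 + k * #|F| * n ^ 2) * W.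
  apply: (@leq_trans (\sum_(P : V * V) \sum_(R : V * V) (W + k * (P \in F) * W))).
    rewrite big_distrr; apply: leq_sum => P _; rewrite big_distrr; apply: leq_sum => R _ /=.
    have TW : T P R <= W.
      rewrite /T /W [leqRHS](bigID (fun v => slot U P R && slot_absorbable v P R)).
      by rewrite /= leq_addr.
    case PF: (P \in F); first by rewrite muln1 (leq_trans _ (leq_addl _ _)) // leq_mul.
    rewrite muln0 mul0n addn0; move: PF; rewrite inE => /existsPn/(_ R).
    rewrite /T; case: (slot U P R) => [|_]; last by rewrite big_pred0_eq muln0.
    by rewrite -ltnNge => /ltnW.
  under eq_bigr => P _ do rewrite sum_nat_const card_prod mulnDr.
  rewrite big_split /= sum_nat_const card_prod -big_distrr /= -big_distrl -big_distrr /=.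
  have -> : \sum_(P : V * V) (P \in F) = #|F|.
    by rewrite -sum1_card [RHS]big_mkcond; apply: eq_bigr => P _; case: (_ \in _).
  rewrite mulnDl leq_add //; last by rewrite mulnn mulnA leq_mul // mulnC.
  by rewrite !expnS expn0 muln1 !mulnA.
have : 2 * n ^ 4 <= n ^ 4 + k * #|F| * n ^ 2.
  by rewrite -(leq_pmul2r W0); apply: leq_trans lo hi.
rewrite mul2n -addnn leq_add2l (expnD n 2 2) leq_pmul2r //.
by rewrite expn_gt0 n0.
Qed.

(** The weights occurring in [derandomized_boosting] are [2 ^ (n - f v)], with [f v]
    the number of slots that already fit [v].  There are [(n + 1) ^ n] of them,
    which is still few for the union bound. *)
Definition hits_slot_pairs := forall (U : {set V}) (f : {ffun V -> 'I_n.+1}) k,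
  k <= S -> n ^ 2 <= S * #|slot_pairs U (fun v => 2 ^ (n - f v)) k| ->
  exists P, P \in slot_pairs U (fun v => 2 ^ (n - f v)) k /\ xe P.1 P.2.

Lemma absorbers (A : {set V}) q u : hits_slot_pairs -> 0 < q ->
  4 * (2 * q) ^ 6 <= S -> S <= n ->
  (forall x y, n <= q * #|common_nbhd e A x y|) ->
  2 * q * (4 * (2 * (4 * (2 * q) ^ 6) * u)) <= n ->
  exists bs, [/\ uniq (flatten bs), {subset flatten bs <= A},
     all (fun b => (size b == 4) && square_path g b) bs,
     size bs = 2 * (4 * (2 * q) ^ 6) * u &
     forall v, 2 ^ u <= n * 2 ^ count (absorbable e v) bs ].
Proof.
move=> hit q0 qS Sn codegA; set K := 4 * (2 * q) ^ 6 => un.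
have K0 : 0 < K by rewrite muln_gt0 expn_gt0 muln_gt0 q0.
have n0 : 0 < n by apply: leq_trans (leq_trans qS Sn); exact: K0.
have Tn : 2 * K * u <= n.
  by apply: leq_trans un; rewrite mulnA leq_pmull // !muln_gt0 q0.
have [||s [[us sA s4] szs boost]] := @derandomized_boosting V (seq V) (absorbable e)
  (fun s => [/\ uniq (flatten s), {subset flatten s <= A} &
      all (fun b => (size b == 4) && square_path g b) s]) K u n K0 Tn; [by [] | | by exists s].
  move=> s [us sA s4] szs.
  have sz4 : size (flatten s) = 4 * size s.
    by apply: size_flatten_const; apply: sub_all s4 => b /andP[].
  pose B := A :\: [set z in flatten s].
  have codegB x y : n <= 2 * q * #|common_nbhd e B x y|.
    have := leq_mul (leqnn (2 * q)) (common_nbhd_setD e A (flatten s) x y); rewrite mulnDr.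
    have : 2 * q * size (flatten s) <= n.
      by apply: leq_trans un; rewrite leq_mul // sz4 leq_mul // ltnW.
    have := codegA x y; rewrite -/B -(mulnA 2 q #|common_nbhd e A x y|).
    move: (q * #|common_nbhd e A x y|) (2 * q * size _) (2 * q * #|_|) => a b c; clear; lia.
  pose f := [ffun v => inord (count (absorbable e v) s) : 'I_n.+1].
  have fE v : f v = count (absorbable e v) s :> nat.
    rewrite ffunE inordK // ltnS (leq_trans (count_size _ _)) //.
    exact: leq_trans (ltnW szs) Tn.
  have W0 : 0 < \sum_v 2 ^ (n - f v).
    have [v _] : exists v : V, v \in V by apply/card_gt0P.
    by rewrite (bigD1 v) //= addn_gt0 expn_gt0.
  have [|[b c] [PF xbc]] := hit B f K qS.
    apply: leq_trans (many_slot_pairs (leq_trans qS Sn) _ codegB W0) _.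
      by rewrite muln_gt0.
    by rewrite leq_mul.
  move: PF; rewrite inE => /existsP[[a d] /andP[ok le]].
  move: ok; rewrite /slot /= => /andP[/and4P[bB cB aB dB]].
  case/andP=> bc /and5P[ad ab ac db dc].
  have neq x y : e x y -> ((x == y) = false) * ((y == x) = false).
    move=> xy; have xNy : (x == y) = false by apply: contraTF xy => /eqP ->; rewrite eirr.
    by split=> //; rewrite eq_sym.
  exists [:: a; b; c; d].
    have Bs z : z \in B -> z \notin flatten s /\ z \in A.
      by rewrite !inE => /andP[].
    have [[aN aA] [bN bA] [cN cA] [dN dA]] := And4 (Bs a aB) (Bs b bB) (Bs c cB) (Bs d dB).
    split.
    - change (is_true (uniq [:: a, b, c, d & flatten s])).
      rewrite !cons_uniq !inE !negb_or bc ad aN bN cN dN us.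
      by rewrite !(neq _ _ ab, neq _ _ ac, neq _ _ db, neq _ _ dc).
    - by move=> z; rewrite /= !inE => /or4P[/eqP->|/eqP->|/eqP->|/orP[/eqP->|/sA]].
    - by rewrite /= s4 andbT (eg ab) (eg ac) (xg xbc) !eg // esym.
  under eq_bigr => v _ do rewrite -fE.
  under [X in _ <= _ * X]eq_bigr => v _ do rewrite -fE.
  apply: leq_trans le _; rewrite leq_mul // leq_eqVlt; apply/orP; left; apply/eqP.
  apply: eq_bigl => v; rewrite /slot_absorbable /absorbable /= andbT.
  by case: (e v a); case: (e v b); case: (e v c).
Qed.
End Boosted.

(** * Almost perfect tilings *)

Section Tiling.
Variables (V : finType) (e xe g : rel V) (S : nat).
Local Notation n := #|V|.
Hypothesis esym : symmetric e.
Hypothesis eg : subrel e g.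
Hypothesis xg : subrel xe g.
Hypothesis hit : hits_rich_pairs e xe S.
Variables (q G t : nat) (V0 : {set V}).
Local Notation l := (4 * t + 2).
Hypothesis q0 : 0 < q.
Hypothesis G0 : 0 < G.
Hypothesis deg : forall x, (q + 2) * n <= 2 * q * #|nbhd e setT x|.
Hypothesis V0big : 4 * q * #|~: V0| <= n.
(* 1 / h bounds the density inside a leftover that contains no tile, and is the
   relative degree that defines heavy vertices; 1 / q2 is the density between
   heavy and leftover vertices available in tiles_on_heavy. *)
Let h := 4 * q * G.
Let q2 := 2 * h * (8 * q * (8 * h)).
Hypothesis q2S : alternating_tile_bound q2 <= S.
Hypothesis hS : alternating_tile_bound h <= S.
Hypothesis Sn : S <= n.
Hypothesis tn2 : 4 * (4 * q2) ^ 2 * (4 * t + 6) <= n.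
Hypothesis tnh : 4 * (4 * h) ^ 2 * (4 * t + 6) <= n.
Hypothesis lhn : 4 * h * l <= n.

Definition tiling (ts : seq (seq V)) :=
  [/\ all (fun b => (size b == l) && square_path g b) ts, uniq (flatten ts) &
      {subset flatten ts <= V0}].

Lemma size_tiling ts : all (fun b => (size b == l) && square_path g b) ts ->
  size (flatten ts) = l * size ts.
Proof. by move=> tiles; apply: size_flatten_const; apply: sub_all tiles => b /andP[]. Qed.

Definition leftover (ts : seq (seq V)) := [set z in V0 | z \notin flatten ts].
Definition heavy ts := [set y | (y \in flatten ts) && (n <= h * #|nbhd e (leftover ts) y|)].

(** Leftover vertices have degree at least [n / 2 + n / q], but few neighbours
    outside [V0] and, on average, among themselves.  So they send more than [n / 2]
    edges each on average to the tiles, and more than [n / 2] vertices of the tiles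
    receive linearly many of them. *)
Lemma heavy_large ts : tiling ts -> n <= G * #|leftover ts| ->
  h * \sum_(a in leftover ts) #|nbhd e (leftover ts) a| <= n ^ 2 ->
  (2 * q + 1) * n <= 4 * q * #|heavy ts|.
Proof.
case=> _ _ tsV0; set U := leftover ts; set D := heavy ts => bigU sparse.
have n0 : 0 < n by apply: leq_trans lhn; rewrite !muln_gt0 q0 G0 addn_gt0 orbT.
have U0 : 0 < #|U|.
  by have := leq_trans n0 bigU; rewrite muln_gt0 => /andP[].
pose Cv := [set z in flatten ts].
have split3 u : #|nbhd e setT u| <= #|nbhd e Cv u| + #|nbhd e U u| + #|nbhd e (~: V0) u|.
  rewrite -addnA (leq_trans _ (leq_add (leqnn _) (leq_card_setU _ _).1)) //.
  rewrite (leq_trans _ (leq_card_setU _ _).1) // subset_leq_card //.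
  apply/subsetP => z; rewrite !inE /= => ->; rewrite !andbT.
  by case: (z \in V0); case: (z \in flatten ts).
have h1 : (q + 2) * n * #|U| <= 2 * q * \sum_(u in U) #|nbhd e setT u|.
  by rewrite mulnC -sum_nat_const big_distrr /=; apply: leq_sum.
have h2 : \sum_(u in U) #|nbhd e setT u| <= \sum_(u in U) #|nbhd e Cv u| +
    \sum_(u in U) #|nbhd e U u| + \sum_(u in U) #|nbhd e (~: V0) u|.
  by rewrite -!big_split /=; apply: leq_sum.
have h3 : 4 * q * \sum_(u in U) #|nbhd e (~: V0) u| <= n * #|U|.
  rewrite [leqRHS]mulnC -sum_nat_const big_distrr /=; apply: leq_sum => u _.
  apply: leq_trans V0big; rewrite leq_mul // subset_leq_card //.
  by apply/subsetP => z; rewrite inE => /andP[].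
have hE X : h * X = G * (4 * q * X) by rewrite /h (mulnC _ G) -mulnA.
have n2U : n ^ 2 <= G * (n * #|U|) by rewrite mulnCA -mulnn leq_mul.
have h4 : 4 * q * \sum_(u in U) #|nbhd e U u| <= n * #|U|.
  rewrite -(leq_pmul2l G0); apply: leq_trans n2U; apply: leq_trans sparse.
  by rewrite hE.
have h5 : h * \sum_(u in U) #|nbhd e Cv u| <= h * #|D| * #|U| + n ^ 2.
  rewrite sum_nbhd // (bigID (mem D)) /= mulnDr leq_add //.
    rewrite -mulnA leq_mul // -sum_nat_const.
    rewrite [leqLHS](eq_bigl (mem D)).
      by apply: leq_sum => y _; rewrite subset_leq_card //; apply/subsetP => z; rewrite inE => /andP[].
    by move=> y; rewrite !inE; case: (y \in _).
  apply: (@leq_trans (\sum_(y : V) n)); last by rewrite sum_nat_const mulnn.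
  rewrite big_distrr big_mkcond /=; apply: leq_sum => y _.
  by case: ifP => // /andP[]; rewrite !inE => -> /=; rewrite -ltnNge => /ltnW.
have h6 : 4 * q * \sum_(u in U) #|nbhd e Cv u| <= 4 * q * #|D| * #|U| + n * #|U|.
  rewrite -(leq_pmul2l G0) mulnDr; apply: leq_trans (leq_add (leqnn _) n2U).
  by move: h5; rewrite -(mulnA h) !hE -(mulnA (4 * q)).
rewrite -(leq_pmul2r U0).
move: h1 (leq_mul (leqnn (4 * q)) h2) h3 h4 h6; rewrite !mulnDr -!mulnA.
rewrite !mulnDl -?mulnA ?mul1n.
move: (q * \sum_(u in U) #|nbhd e setT u|) (q * \sum_(u in U) #|nbhd e Cv u|).
move: (q * \sum_(u in U) #|nbhd e U u|) (q * \sum_(u in U) #|nbhd e (~: V0) u|).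
move: (q * (n * #|U|)) (n * #|U|) (q * (#|D| * #|U|)).
clear; lia.
Qed.

Lemma tile_in_leftover ts : tiling ts ->
  n ^ 2 <= h * \sum_(a in leftover ts) #|nbhd e (leftover ts) a| ->
  exists s, tiling (s :: ts).
Proof.
case=> tiles uts tsV0 dens.
have h0 : 0 < h by rewrite !muln_gt0 q0 G0.
have [s [sa [sb [[us sqs] pes saU sbU [za zb]]]]] :=
  alternating_tile esym eg xg hit h0 hS Sn tnh dens.
have sU z : z \in s -> z \in leftover ts.
  by rewrite (perm_mem pes) mem_cat => /orP[/saU|/sbU].
exists s; split => /=.
- by rewrite tiles sqs (perm_size pes) size_cat za zb !andbT; apply/eqP; clear; lia.
- rewrite cat_uniq us uts andbT; apply/hasPn => z; apply: contraL => /sU.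
  by rewrite inE => /andP[].
- by move=> z; rewrite mem_cat => /orP[/sU|/tsV0]; rewrite ?inE // => /andP[].
Qed.

(** A set [D] that slightly exceeds half of [k] tiles gives rise to [k + 1] tiles:
    each of them takes less than half of its vertices in [D], the rest being
    taken from [U].  The upper bound on [l * k] keeps the loss in [U] below half
    of the degrees. *)
Lemma tiles_on_heavy (D U : {set V}) k : [disjoint D & U] ->
  (forall y, y \in D -> n <= h * #|nbhd e U y|) ->
  (4 * q + 1) * (l * k) <= 8 * q * #|D| -> 4 * h * (l * k) <= n <= 8 * h * (l * k) ->
  forall j, j <= k.+1 -> exists ts,
   [/\ all (fun b => (size b == l) && square_path g b) ts, uniq (flatten ts),
       {subset flatten ts <= D :|: U}, size ts = j &
       count (mem D) (flatten ts) = 2 * t * j].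
Proof.
move=> DU degD bigD /andP[kn nk].
elim=> [|j IH] jk; first by exists [::]; split; rewrite ?muln0.
have [ts [tiles uts tsDU szts cntD]] := IH (ltnW jk).
rewrite ltnS in jk.
pose D1 := D :\: [set z in flatten ts]; pose U1 := U :\: [set z in flatten ts].
have bigD1 : #|D| <= #|D1| + 2 * t * j.
  rewrite -cntD -(cardsID [set z in flatten ts] D) addnC leq_add //.
  rewrite -size_filter -(card_uniqP (filter_uniq _ uts)) subset_leq_card //.
  by apply/subsetP => z; rewrite mem_filter !inE => /andP[-> ->].
have l0 : 0 < l by rewrite addn_gt0 orbT.
have D1k : l * k <= 8 * q * #|D1|.
  have lo := leq_mul (leqnn (8 * q)) bigD1.
  have jl : 8 * q * (2 * t * j) <= 4 * q * (l * k).
    rewrite (_ : 8 * q * (2 * t * j) = 4 * q * (4 * t * j)); last by clear; lia.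
    by rewrite leq_mul // leq_mul // leq_addr.
  have {}bigD : 4 * q * (l * k) + l * k <= 8 * q * #|D|.
    by move: bigD; rewrite [leqLHS]mulnDl mul1n.
  rewrite mulnDr in lo; move: bigD lo jl.
  clear; lia.
have degD1 y : y \in D1 -> n <= 2 * h * #|nbhd e U1 y|.
  rewrite inE => /andP[_ yD].
  have nbU : #|nbhd e U y| <= #|nbhd e U1 y| + l * j.
    rewrite -szts -(size_tiling tiles) -(cardsID [set z in flatten ts] (nbhd e U y)) addnC leq_add //.
      by rewrite subset_leq_card //; apply/subsetP => z; rewrite !inE andbA.
    by rewrite (leq_trans (subset_leq_card (subsetIr _ _))) // cardsE card_size.
  have lo := leq_mul (leqnn h) nbU.
  have jl : h * (l * j) <= h * (l * k) by rewrite !leq_mul.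
  move: (degD y yD) lo jl kn; rewrite mulnDr -!mulnA.
  move: (h * (l * j)) (h * (l * k)) (h * #|nbhd e U y|) (h * #|nbhd e U1 y|); clear; lia.
have dens : n ^ 2 <= q2 * \sum_(y in D1) #|nbhd e U1 y|.
  have le1 : n * #|D1| <= 2 * h * \sum_(y in D1) #|nbhd e U1 y|.
    by rewrite mulnC -sum_nat_const big_distrr /=; apply: leq_sum.
  have le2 : n <= 8 * q * (8 * h) * #|D1|.
    by apply: leq_trans nk _; rewrite (mulnC (8 * q)) -[leqRHS]mulnA leq_mul.
  rewrite -mulnn (leq_trans (leq_mul (leqnn n) le2)) //.
  by rewrite mulnCA /q2 (mulnC (2 * h)) -[leqRHS]mulnA leq_mul.
have q20 : 0 < q2 by rewrite !muln_gt0 q0 G0.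
have [s [sa [sb [[us sqs] pes saU sbU [za zb]]]]] :=
  alternating_tile esym eg xg hit q20 q2S Sn tn2 dens.
have sDU z : z \in s -> z \in D1 :|: U1.
  by rewrite (perm_mem pes) mem_cat !inE => /orP[/saU|/sbU]; rewrite !inE => ->; rewrite ?orbT.
exists (s :: ts); split => /=.
- by rewrite tiles sqs (perm_size pes) size_cat za zb !andbT; apply/eqP; clear; lia.
- rewrite cat_uniq us uts andbT; apply/hasPn => z; apply: contraL => /sDU.
  by rewrite !inE => /orP[] /andP[].
- move=> z; rewrite mem_cat => /orP[/sDU|/tsDU//]; rewrite !inE.
  by case/orP=> /andP[_ ->]; rewrite ?orbT.
- by rewrite szts.
rewrite count_cat cntD (seq.permP pes) count_cat.
have -> : count (mem D) sa = size sa.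
  by apply/eqP; rewrite -all_count; apply/allP => z /saU; rewrite inE => /andP[].
have -> : count (mem D) sb = 0.
  apply/eqP; rewrite -leqn0 leqNgt -has_count; apply/hasPn => z /sbU.
  rewrite inE => /andP[_ zU]; apply/negP => zD.
  by rewrite (disjointFr DU zD) in zU.
by rewrite za addn0 mulnS.
Qed.

(** If the leftover is dense it contains one more tile.  Otherwise the heavy vertices
    fill more than half of the tiles on average, hence slightly more than half of
    each tile in a set of linear size (the rich ones).  Break up [k] rich tiles
    and rebuild [k + 1] tiles from their heavy vertices and the leftover. *)
Lemma improve_tiling ts : tiling ts -> n < G * #|leftover ts| ->
  exists2 ts', tiling ts' & size ts < size ts'.
Proof.
move=> tts bigU; have [tiles uts tsV0] := tts.
have h0 : 0 < h by rewrite !muln_gt0 q0 G0.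
have [/(tile_in_leftover tts)[s ?]|/ltnW sparse] :=
  leqP (n ^ 2) (h * \sum_(a in leftover ts) #|nbhd e (leftover ts) a|).
  by exists (s :: ts).
have bigD := heavy_large tts (ltnW bigU) sparse.
set D := heavy ts in bigD; set U := leftover ts in bigU sparse.
have l0 : 0 < l by rewrite addn_gt0 orbT.
pose rich b := (4 * q + 1) * l <= 8 * q * count (mem D) b.
have richk : n <= 8 * q * (l * count rich ts).
  have cD : #|D| <= count (mem D) (flatten ts).
    rewrite -size_filter -(card_uniqP (filter_uniq _ uts)) subset_leq_card //.
    by apply/subsetP => z zD; rewrite mem_filter /= zD; move: zD; rewrite inE => /andP[].
  have lts : l * size ts <= n by rewrite -(size_tiling tiles) -(card_uniqP uts) max_card.
  have cnt : 8 * q * count (mem D) (flatten ts) <=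
      8 * q * (l * count rich ts) + (4 * q + 1) * (l * size ts).
    elim: (ts) tiles => [|b bs IH] /=; first by rewrite !muln0.
    case/andP=> /andP[/eqP bl _] /IH{}IH; rewrite count_cat mulnDr.
    rewrite mulnS !(mulnDr l) !(mulnDr (8 * q)) (mulnDr (4 * q + 1)) addnACA leq_add //.
    rewrite /rich; case: (leqP ((4 * q + 1) * l)) => [_|/ltnW le]; last by rewrite muln0 muln0.
    by rewrite muln1 (leq_trans _ (leq_addr _ _)) // leq_mul // -bl count_size.
  have := leq_trans (leq_mul (leqnn (8 * q)) cD) cnt.
  have := leq_mul (leqnn (4 * q + 1)) lts; move: bigD.
  move: (l * count rich ts) (l * size ts) => a b; clear; lia.
pose k := n %/ (4 * h * l).
have kn : 4 * h * (l * k) <= n by rewrite mulnA mulnC leq_divM.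
have d0 : 0 < 4 * h * l by rewrite !muln_gt0 q0 G0.
have nk : n <= 8 * h * (l * k).
  have k0 : 0 < k by rewrite divn_gt0.
  have := ltnW (ltn_ceil n d0); rewrite -/k => /leq_trans; apply.
  rewrite (_ : 8 * h * (l * k) = (k + k) * (4 * h * l)); last by clear; lia.
  by rewrite leq_mul // -addn1 leq_add.
have kr : k <= count rich ts.
  have ql0 : 0 < 8 * q * l by rewrite !muln_gt0 q0.
  have := leq_trans kn richk.
  have -> : 4 * h * (l * k) = 8 * q * l * (2 * G * k) by rewrite /h; clear; lia.
  rewrite (mulnA (8 * q)) leq_pmul2l // => /(leq_trans _) -> //.
  by rewrite leq_pmull // muln_gt0 G0.
pose ts1 := take k (filter rich ts).
pose ts2 := drop k (filter rich ts) ++ filter (predC rich) ts.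
have pts : perm_eq ts (ts1 ++ ts2).
  by rewrite /ts1 /ts2 catA cat_take_drop perm_sym perm_filterC.
have szts1 : size ts1 = k by rewrite size_takel // size_filter.
have := perm_flatten pts; rewrite flatten_cat => pfl.
have uts12 : uniq (flatten ts1 ++ flatten ts2) by rewrite -(perm_uniq pfl).
pose D1 := [set y in flatten ts1 | y \in D].
have D1big : (4 * q + 1) * (l * k) <= 8 * q * #|D1|.
  have : count (mem D) (flatten ts1) <= #|D1|.
    move: uts12; rewrite cat_uniq => /andP[uts1 _].
    rewrite -size_filter -(card_uniqP (filter_uniq _ uts1)) subset_leq_card //.
    by apply/subsetP => z; rewrite mem_filter !inE => /andP[-> ->].
  move=> /(leq_mul (leqnn (8 * q))); apply: leq_trans; rewrite -szts1.
  have : all rich ts1.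
    by apply/allP => b /mem_take; rewrite mem_filter => /andP[].
  elim: (ts1) => [|b bs IH] /=; first by rewrite !muln0.
  case/andP=> rb /IH; rewrite count_cat mulnS mulnDr (mulnDr (8 * q)).
  by apply: leq_add.
have D1U : [disjoint D1 & U].
  apply/pred0P => z /=; rewrite !inE; apply/negP => /andP[/andP[_ /andP[zts _]] /andP[_]].
  by rewrite zts.
have [y||new [tnew unew newDU sznew _]] := tiles_on_heavy D1U _ D1big _ (leqnn k.+1).
- by rewrite !inE => /and3P[].
- by rewrite kn nk.
exists (new ++ ts2); last by rewrite (perm_size pts) !size_cat sznew szts1.
split.
- by rewrite all_cat tnew; move: tiles; rewrite (perm_all _ pts) all_cat => /andP[].
- rewrite flatten_cat cat_uniq unew; move: uts12; rewrite cat_uniq => /and3P[_ dis ->].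
  rewrite andbT; apply/hasPn => z z2; apply/negP => /newDU; rewrite !inE.
  case/orP=> [/andP[z1 _]|/andP[_]]; first by move/hasPn/(_ z z2): dis; rewrite /= z1.
  by rewrite (perm_mem pfl) mem_cat z2 orbT.
move=> z; rewrite flatten_cat mem_cat => /orP[/newDU|z2]; last first.
  by apply: tsV0; rewrite (perm_mem pfl) mem_cat z2 orbT.
rewrite !inE => /orP[/andP[z1 _]|/andP[]//].
by apply: tsV0; rewrite (perm_mem pfl) mem_cat z1.
Qed.

Lemma almost_tiling : exists2 ts, tiling ts & G * #|leftover ts| <= n.
Proof.
suff grow m ts : tiling ts -> n <= size ts + m ->
    exists2 ts', tiling ts' & G * #|leftover ts'| <= n.
  by apply: (grow n [::]); [split | ].
elim: m ts => [|m IH] ts tts szts.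
  have [le|/(improve_tiling tts)[ts' [tiles uts _] lt]] := leqP (G * #|leftover ts|) n.
    by exists ts.
  have : size (flatten ts') <= n by rewrite -(card_uniqP uts) max_card.
  have : size ts' <= l * size ts' by rewrite leq_pmull // addn_gt0 orbT.
  by rewrite (size_tiling tiles); move: (l * size ts') lt szts; clear; lia.
have [le|/(improve_tiling tts)[ts' tts' lt]] := leqP (G * #|leftover ts|) n.
  by exists ts.
by apply: (IH ts') => //; move: lt szts; clear; lia.
Qed.
End Tiling.

(** * The square of a Hamilton cycle in the deterministic setting *)

Lemma cube_le_exp2 k : 11 <= k -> k.+1 ^ 3 <= 2 ^ k.
Proof.
elim: k => // k IH; rewrite leq_eqVlt => /orP[/eqP <- //|k11].
rewrite ltnS in k11; rewrite (expnS 2); apply: leq_trans (leq_mul (leqnn 2) (IH k11)).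
by rewrite !expnS !expn0; move: k11; clear; nia.
Qed.

Lemma sqr_le_exp2_div B n : 0 < B -> B * (11 + B ^ 2) <= n -> n ^ 2 <= 2 ^ (n %/ B).
Proof.
move=> B0 Bn; set k := n %/ B.
have kB : 11 + B ^ 2 <= k by rewrite leq_divRL // mulnC.
have nk : n <= k.+1 * B by rewrite ltnW // ltn_ceil.
apply: leq_trans (cube_le_exp2 (leq_trans (leq_addr _ _) kB)).
apply: leq_trans (leq_mul nk nk) _; rewrite mulnACA mulnn (expnSr _ 2) leq_mul //.
by rewrite mulnn (leq_trans _ (leqnSn k)) // (leq_trans _ kB) // leq_addl.
Qed.

Lemma div_half n B : 0 < B <= n -> n <= 2 * B * (n %/ B).
Proof.
case/andP=> B0 Bn; have k0 : 0 < n %/ B by rewrite divn_gt0.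
apply: leq_trans (ltnW (ltn_ceil n B0)) _.
by rewrite mulnAC leq_mul // mul2n -addnn -addn1 leq_add.
Qed.

Section Assembly.
Variables (V : finType) (e xe g : rel V) (S q : nat).
Local Notation n := #|V|.
Hypothesis esym : symmetric e.
Hypothesis eirr : irreflexive e.
Hypothesis eg : subrel e g.
Hypothesis xg : subrel xe g.
Hypothesis hit : hits_rich_pairs e xe S.
Hypothesis hit_slots : hits_slot_pairs e xe S.
Hypothesis q0 : 0 < q.
Hypothesis Sn : S <= n.
Hypothesis codeg : forall x y, n <= q * #|common_nbhd e setT x y|.

(** The slots are connected through vertices outside of them, before the reservoir
    is set aside: the reservoir has to be smaller than the number of slots, so it
    could not accommodate six vertices per slot. *)
Lemma absorbing_path w : let K := 4 * (2 * q) ^ 6 in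
  K <= S -> connect_bound (2 * q) <= S -> 80 * q * K * w <= n -> 0 < w -> n <= 2 ^ w ->
  exists B, [/\ uniq (flatten B), square_path g (flatten B), 1 < size (flatten B),
    size (flatten B) <= 40 * K * w & forall v, w <= count (absorbable e v) B].
Proof.
move=> K KS bS Kwn w0 nw; have K0 : 0 < K by rewrite muln_gt0 expn_gt0 muln_gt0 q0.
have n0 : 0 < n by apply: leq_trans Sn; apply: leq_trans KS.
have codegT x y : n <= 2 * q * #|common_nbhd e setT x y|.
  by rewrite (leq_trans (codeg x y)) // leq_mul // leq_pmull.
have [|bs [ubs _ tiles szbs cap]] := absorbers (A := setT) (u := 2 * w)
  esym eirr eg xg hit_slots q0 KS Sn codeg.
  apply: leq_trans Kwn; rewrite -/K.
  by rewrite (_ : _ * _ = 32 * q * K * w) ?leq_mul //; clear; lia.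
rewrite -/K in szbs.
have szf : size (flatten bs) = 4 * size bs.
  by apply: size_flatten_const; apply: sub_all tiles => b /andP[].
case: bs => [|p0 ps] in ubs tiles szbs cap szf *.
  by move: szbs K0 w0; rewrite /=; clear; nia.
move: (tiles) => /= /andP[/andP[/eqP p04 sqp0] tilesp].
have p0_2 : 1 < size p0 by rewrite p04.
have [s [c [d p0E]]] := split_head2 p0_2.
have gcd : g c d by move: sqp0; rewrite p0E => /square_path_first_edge.
have tot : 2 * q * (10 * size (p0 :: ps)) <= n.
  by apply: leq_trans Kwn; rewrite szbs; clear; lia.
have [|||ks [B [szks ks6 uks ksC [pB sqB]]]] := @chain_paths V e xe g S (2 * q)
  esym eirr eg xg codegT hit _ ps (setT :\: [set z in flatten (p0 :: ps)]) p0 c d bS Sn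
  _ _ p0_2 sqp0 gcd.
- by rewrite muln_gt0 q0.
- move=> x y; have := leq_mul (leqnn (2 * q)) (common_nbhd_setD e setT (flatten (p0 :: ps)) x y).
  rewrite szf mulnDr; have := codeg x y; move: tot.
  rewrite (_ : size (p0 :: ps) = (size ps).+1) // -!mulnA.
  move: (q * #|common_nbhd e setT x y|) (q * #|_|) (size ps) => A B m; clear; nia.
- by apply: sub_all tilesp => b /andP[/eqP -> ->].
have pBB : perm_eq (p0 :: B) (ks ++ (p0 :: ps)).
  rewrite -(cat1s p0 ps) perm_sym perm_catCA /= perm_cons perm_sym.
  exact: pB.
have pf : perm_eq (flatten (p0 :: B)) (flatten ks ++ flatten (p0 :: ps)).
  by rewrite -flatten_cat; apply: perm_flatten.
have szk : size (flatten ks) = 6 * size ks by exact: size_flatten_const.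
exists (p0 :: B); split.
- rewrite (perm_uniq pf) cat_uniq uks ubs andbT; apply/hasPn => z zb.
  by apply/negP => /ksC; rewrite !inE zb.
- by move: sqB; rewrite catA => /square_path_catl.
- by rewrite /= size_cat ltn_addr.
- rewrite (perm_size pf) size_cat szk szf szks.
  by move: szbs => /=; clear; lia.
move=> v; rewrite (seq.permP pBB) count_cat (leq_trans _ (leq_addl _ _)) //.
have := cap v; rewrite mul2n -addnn expnD => le.
have /leq_trans/(_ (leq_mul nw (leqnn _))) := le.
by rewrite leq_pmul2l ?expn_gt0 // leq_exp2l.
Qed.

(** Here [w] is the number of vertices that can be absorbed, [16 q v] the size of the
    reservoir, and tiles have length [4 t + 2].  The last two conditions say that
    the tiles are so few that the reservoir can connect them, and that the
    reservoir together with the leftover of the tiling can be absorbed. *)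
Lemma square_cycle_from w v t G p :
  let K := 4 * (2 * q) ^ 6 in
  let h := 4 * q * G in let q2 := 2 * h * (8 * q * (8 * h)) in
  (forall x, (q + 2) * n <= 2 * q * #|nbhd e setT x|) ->
  K <= S -> connect_bound (2 * q) <= S -> connect_bound p <= S ->
  alternating_tile_bound q2 <= S -> alternating_tile_bound h <= S ->
  4 * (4 * q2) ^ 2 * (4 * t + 6) <= n -> 4 * (4 * h) ^ 2 * (4 * t + 6) <= n ->
  4 * h * (4 * t + 2) <= n ->
  0 < G -> q <= p ->
  80 * q * K * w <= n -> 0 < w -> n <= 2 ^ w -> n ^ 2 <= 2 ^ v ->
  64 * q ^ 2 * v <= n -> 4 * q * (40 * K * w + 16 * q * v) <= n ->
  (forall m, (4 * t + 2) * m <= n -> n + p * (6 * m) <= p * v) ->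
  (forall m, G * m <= n -> m + 16 * q * v <= w) ->
  exists s, [/\ uniq s, size s = n & square_path g (s ++ take 2 s)].
Proof.
move=> K h q2 deg KS cS1 cS2 tS1 tS2 bn1 bn2 bn3 G0 qp Kw w0 nw nv qv V0n chain_ok left_ok.
have p0 : 0 < p by apply: leq_trans qp.
have n0 : 0 < n.
  by apply: leq_trans Sn; apply: leq_trans KS; rewrite muln_gt0 expn_gt0 muln_gt0 q0.
have [BA [uA sqA A2 szA capA]] := absorbing_path KS cS1 Kw w0 nw.
rewrite -/K in szA; clearbody K.
set AP := flatten BA in uA sqA A2 szA.
have AP_n : 2 * q * size AP <= n.
  apply: leq_trans Kw; rewrite (_ : 80 * q * K * w = 2 * q * (40 * K * w)) ?leq_mul //.
  by clear; lia.
have codegAP x y : n <= 2 * q * #|common_nbhd e (setT :\: [set z in AP]) x y|.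
  have := leq_mul (leqnn (2 * q)) (common_nbhd_setD e setT AP x y).
  have := codeg x y; move: AP_n; rewrite mulnDr -(mulnA 2 q #|common_nbhd e setT x y|).
  move: (2 * q * size AP) (q * #|common_nbhd e setT x y|) (2 * q * #|common_nbhd e (_ :\: _) x y|).
  clear; lia.
have [||r [ur rA szr codegR]] := @reservoir V e (setT :\: [set z in AP]) (2 * q) (2 * v) n0 _ codegAP.
- by rewrite muln_gt0.
- by apply: leq_trans qv; rewrite -mulnn; clear; lia.
have szrE : size r = 16 * q * v by rewrite szr; clear; lia.
pose R := [set z in r].
have codegRv x y : v <= #|common_nbhd e R x y|.
  have := codegR x y; rewrite mul2n -addnn expnD -/R => le.
  have /leq_trans/(_ (leq_mul nv (leqnn _))) := le.
  by rewrite leq_pmul2l ?expn_gt0 // leq_exp2l.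
pose V0 := setT :\: [set z in AP] :\: R.
have V0C : 4 * q * #|~: V0| <= n.
  apply: leq_trans V0n; rewrite leq_mul // -szrE.
  apply: (@leq_trans (#|[set z in AP]| + #|R|)).
    rewrite (leq_trans _ (leq_card_setU _ _).1) // subset_leq_card //.
    apply/subsetP => z; rewrite !inE /= negb_and negb_and !negbK orbF.
    by rewrite orbC.
  by rewrite !cardsE leq_add // ?card_size // (leq_trans (card_size _)).
have [ts [tiles uts tsV0] leftU] :=
  @almost_tiling V e xe g S esym eg xg hit q G t V0 q0 G0 deg V0C tS1 tS2 Sn bn1 bn2 bn3.
have szts : (4 * t + 2) * size ts <= n.
  by rewrite -(size_tiling tiles) -(card_uniqP uts) max_card.
have [s [c [d APE]]] := split_head2 A2.
have gcd : g c d by move: sqA; rewrite APE => /square_path_first_edge.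
have codegp x y : n <= p * #|common_nbhd e setT x y|.
  by rewrite (leq_trans (codeg x y)) // leq_mul.
have [||ks [B [szks ks6 uks ksR [pB sqB]]]] := @chain_paths V e xe g S p
  esym eirr eg xg codegp hit p0 ts R AP c d cS2 Sn _ _ A2 sqA gcd.
- by move=> x y; apply: leq_trans (chain_ok _ szts) _; rewrite leq_mul.
- by apply: sub_all tiles => b /andP[/eqP -> ->]; rewrite addn2.
pose BB := BA ++ B.
have BBE : flatten BB = AP ++ flatten B by rewrite flatten_cat.
have pfB : perm_eq (flatten B) (flatten ks ++ flatten ts).
  by rewrite -flatten_cat; apply: perm_flatten.
have uBB : uniq (flatten BB).
  rewrite BBE cat_uniq uA (perm_uniq pfB) cat_uniq uks uts andbT /=.
  apply/andP; split; apply/hasPn => z.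
    rewrite (perm_mem pfB) mem_cat => /orP[/ksR|/tsV0]; rewrite !inE.
      by move=> /rA; rewrite !inE => /andP[].
    by case/and3P.
  by move=> /tsV0; rewrite !inE => /andP[zr _]; apply: contra zr => /ksR; rewrite inE.
pose L := enum [set z | z \notin flatten BB].
have szL : size L <= w.
  apply: leq_trans (left_ok _ leftU); rewrite -cardE.
  rewrite -szrE.
  apply: (@leq_trans (#|leftover V0 ts| + #|R|)); last first.
    by rewrite leq_add2l cardsE card_size.
  rewrite (leq_trans _ (leq_card_setU _ _).1) // subset_leq_card //.
  apply/subsetP => z; rewrite !inE BBE mem_cat (perm_mem pfB) mem_cat !negb_or.
  by case/and3P=> -> _ ->; case: (z \in r).
have [|||f [pf hf sqf]] := @absorb_leftover V e g esym eg L BB c d.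
- by rewrite BBE APE /= take0.
- by rewrite BBE -catA.
- move=> z _; rewrite (leq_trans szL) // (leq_trans (capA z)) //.
  by rewrite count_cat leq_addr.
have uf : uniq f.
  rewrite (perm_uniq pf) cat_uniq uBB enum_uniq andbT; apply/hasPn => z.
  by rewrite mem_enum inE.
exists f; split => //; last by rewrite hf.
rewrite -(card_uniqP uf); apply: eq_card => z; rewrite (perm_mem pf) mem_cat mem_enum.
by rewrite !inE orbN.
Qed.
End Assembly.

Lemma codeg_of_deg (V : finType) (e : rel V) q : 0 < q ->
  (forall x, (q + 2) * #|V| <= 2 * q * #|nbhd e setT x|) ->
  forall x y, #|V| <= q * #|common_nbhd e setT x y|.
Proof.
move=> q0 deg x y; have := cardsUI (nbhd e setT x) (nbhd e setT y).
have -> : nbhd e setT x :&: nbhd e setT y = common_nbhd e setT x y.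
  by apply/setP => z; rewrite !inE.
have := max_card (mem (nbhd e setT x :|: nbhd e setT y)).
move: (deg x) (deg y); move: #|nbhd e setT x| #|nbhd e setT y| #|_ :|: _| #|common_nbhd _ _ _ _| #|V|.
move=> a b c d n h1 h2 le_cn abE.
have : q * (a + b) <= q * (n + d) by rewrite leq_mul // -abE leq_add2r.
by move: h1 h2; clear; lia.
Qed.

(** The constants are chosen in the order [w], [v], [t]: [B1] makes the absorbing path
    small, [B2] makes the reservoir small with respect to [w], and the length of
    the tiles makes them few with respect to [v]. *)
Lemma square_cycle q : 0 < q -> exists S n0,
  forall (V : finType) (e xe g : rel V), symmetric e -> irreflexive e ->
    subrel e g -> subrel xe g -> n0 <= #|V| ->
    (forall x, (q + 2) * #|V| <= 2 * q * #|nbhd e setT x|) ->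
    hits_rich_pairs e xe S -> hits_slot_pairs e xe S ->
  exists s, [/\ uniq s, size s = #|V| & square_path g (s ++ take 2 s)].
Proof.
move=> q0; have [K KE] : exists K, K = 4 * (2 * q) ^ 6 by exists (4 * (2 * q) ^ 6).
have [B1 B1E] : exists B, B = 320 * q * K by exists (320 * q * K).
have [B2 B2E] : exists B, B = 64 * q * B1 by exists (64 * q * B1).
have [h hE] : exists h, h = 4 * q * (4 * B1) by exists (4 * q * (4 * B1)).
have [q2 q2E] : exists q2, q2 = 2 * h * (8 * q * (8 * h)) by exists (2 * h * (8 * q * (8 * h))).
have K0 : 0 < K by rewrite KE muln_gt0 expn_gt0 muln_gt0 q0.
have B10 : 0 < B1 by rewrite B1E !muln_gt0 q0 K0.
have B20 : 0 < B2 by rewrite B2E !muln_gt0 q0 B10.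
pose S := K + connect_bound (2 * q) + connect_bound (4 * B2) +
  alternating_tile_bound q2 + alternating_tile_bound h.
pose m1 := 4 * (4 * q2) ^ 2 * (4 * (6 * B2) + 6).
pose m2 := 4 * (4 * h) ^ 2 * (4 * (6 * B2) + 6).
pose m3 := 4 * h * (4 * (6 * B2) + 2).
pose m4 := B1 * (11 + B1 ^ 2). pose m5 := B2 * (11 + B2 ^ 2).
exists S, (S + m1 + m2 + m3 + m4 + m5) => V e xe g esym eirr eg xg n_big deg hit hit_slots.
have addl a b c : a <= b -> a <= b + c by move=> ab; rewrite (leq_trans ab) ?leq_addr.
have addr a b c : a <= c -> a <= b + c by move=> ac; rewrite (leq_trans ac) ?leq_addl.
have nS : S <= #|V| by apply: leq_trans n_big; do 5!apply: (@addl).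
have n1 : m1 <= #|V| by apply: leq_trans n_big; do 4!apply: (@addl); apply: (@addr).
have n2 : m2 <= #|V| by apply: leq_trans n_big; do 3!apply: (@addl); apply: (@addr).
have n3 : m3 <= #|V| by apply: leq_trans n_big; do 2!apply: (@addl); apply: (@addr).
have n4 : m4 <= #|V| by apply: leq_trans n_big; apply: (@addl); apply: (@addr).
have n5 : m5 <= #|V| by apply: leq_trans n_big; apply: (@addr).
have pw1 := sqr_le_exp2_div B10 n4; have pw2 := sqr_le_exp2_div B20 n5.
have B1n : B1 <= #|V| by apply: leq_trans n4; rewrite leq_pmulr.
have B2n : B2 <= #|V| by apply: leq_trans n5; rewrite leq_pmulr.
have w1 := leq_divM #|V| B1; have w2 := @div_half #|V| B1.
have v1 := leq_divM #|V| B2; have v2 := @div_half #|V| B2.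
rewrite B10 B1n in w2; rewrite B20 B2n in v2.
apply: (@square_cycle_from V e xe g S q esym eirr eg xg hit hit_slots q0 nS
  (codeg_of_deg q0 deg) (#|V| %/ B1) (#|V| %/ B2) (6 * B2) (4 * B1) (4 * B2) deg);
  rewrite -?KE -?hE -?q2E //.
- by do 4!apply: (@addl).
- by do 3!apply: (@addl); apply: (@addr).
- by do 2!apply: (@addl); apply: (@addr).
- by apply: (@addl); apply: (@addr).
- exact: (@addr).
- by rewrite muln_gt0.
- by rewrite B2E B1E -!mulnA !(mulnCA _ q) leq_pmulr // !muln_gt0 q0 K0.
- apply: leq_trans w1; rewrite B1E; move: (#|V| %/ _) => w; clear; lia.
- by rewrite divn_gt0.
- by apply: leq_trans pw1; rewrite -mulnn leq_pmulr // (leq_trans B10).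
- apply: leq_trans v1; rewrite B2E B1E; move: (#|V| %/ _) => v.
  have : q * q * v <= q * q * v * K by rewrite leq_pmulr.
  by rewrite -mulnn; clear; lia.
- move: w1 v1; rewrite B2E; move: (#|V| %/ _) (#|V| %/ B1) => v w; rewrite B1E.
  have : q * q * v <= q * q * v * K by rewrite leq_pmulr.
  by clear; lia.
- move=> m; move: (v2 isT); move: #|V| (#|V| %/ B2) => n v; clear; lia.
- move=> m Gm; rewrite -(leq_pmul2l (_ : 0 < 4 * B1)) ?muln_gt0 //.
  move: Gm (w2 isT) v1; rewrite B2E; move: #|V| (#|V| %/ _) (#|V| %/ B1) => n v w.
  clear; lia.
Qed.

(** * Random edge sets meet all the dense families *)

Lemma ffact_ratio S M N m : S * M <= S.-1 * N -> M <= N ->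
  S ^ m * M ^_ m <= S.-1 ^ m * N ^_ m.
Proof.
move=> SMN MN; elim: m => [|m IH]; first by rewrite !expn0 !ffactn0.
rewrite !ffactnSr !expnSr !mulnA !(mulnAC _ _ (_ ^_ m)) -!(mulnA (_ * _)).
apply: leq_mul => //; have [mM|Mm] := leqP m M; last first.
  by rewrite (_ : M - m = 0) ?muln0 //; apply/eqP; rewrite subn_eq0 ltnW.
rewrite -(leq_add2r (S * m)) -mulnDr subnK // (leq_trans SMN) //.
rewrite -{1}(subnK (leq_trans mM MN)) mulnDr leq_add2l leq_mul //.
exact: leq_pred.
Qed.

Lemma bin_ratio S M N m : S * M <= S.-1 * N -> M <= N ->
  S ^ m * 'C(M, m) <= S.-1 ^ m * 'C(N, m).
Proof.
move=> SMN MN; rewrite -(leq_pmul2r (fact_gt0 m)) -!mulnA !bin_ffact.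
exact: ffact_ratio.
Qed.

Section Hitting.
Variables (n S m : nat).
Local Notation N := 'C(n, 2).

Definition edges_of (F : {set 'I_n * 'I_n}) : {set {set 'I_n}} :=
  [set [set p.1; p.2] | p in F].

Lemma card_edges_of (F : {set 'I_n * 'I_n}) : #|F| <= 2 * #|edges_of F|.
Proof.
rewrite -sum1_card (partition_big (fun p => [set p.1; p.2]) (mem (edges_of F))) /=; last first.
  by move=> p pF; apply: imset_f.
rewrite mulnC -sum_nat_const; apply: leq_sum => f /imsetP[[x y] _ ->].
rewrite sum1dep_card; apply: (@leq_trans #|[set (x, y); (y, x)]|); last first.
  by rewrite cards2; case: (_ == _).
apply: subset_leq_card; apply/subsetP => -[a b]; rewrite !inE /= !xpair_eqE => /andP[_ /eqP E].
have := set21 a b; have := set22 a b; have := set21 x y; have := set22 x y.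
rewrite {1 2}E -{1 2}E !inE.
by do 4![case/orP=> /eqP ?]; subst; rewrite ?eqxx ?orbT.
Qed.

Lemma card_complete : #|complete_graph n| = N.
Proof. by have := card_draws 'I_n 2; rewrite card_ord. Qed.

Lemma card_edge_sets : #|edge_sets_of_size n m| = 'C(N, m).
Proof. by rewrite cards_draws card_complete. Qed.

(** An edge set of size [m] that misses a set with at least a fraction [1 / S] of all
    edges is one of at most [(1 - 1 / S) ^ m * 'C(N, m)]. *)
Lemma card_missing (F : {set 'I_n * 'I_n}) :
  (forall p, p \in F -> p.1 != p.2) -> n ^ 2 <= S * #|F| ->
  S ^ m * #|[set X in edge_sets_of_size n m | [disjoint X & edges_of F]]|
    <= S.-1 ^ m * 'C(N, m).
Proof.
move=> offdiag dense; set E := edges_of F.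
have EK : E \subset complete_graph n.
  by apply/subsetP => f /imsetP[p /offdiag p12 ->]; rewrite inE cards2 p12.
have -> : #|[set X in edge_sets_of_size n m | [disjoint X & E]]| = 'C(N - #|E|, m).
  rewrite -card_complete -cardsDS // -cards_draws; apply: eq_card => X.
  by rewrite !inE subsetD andbAC.
have EN : #|E| <= N by rewrite -card_complete subset_leq_card.
apply: bin_ratio; last by rewrite leq_subr.
have SE : N <= S * #|E|.
  rewrite -(leq_pmul2l (_ : 0 < 2)) // -{1}[2]/(2`!) mulnC bin_ffact.
  rewrite mulnCA (leq_trans (leq_trans _ dense)) //; last by rewrite leq_mul // card_edges_of.
  by rewrite !ffactnS ffactn0 muln1 -mulnn leq_mul // leq_pred.
rewrite mulnBr -subn1 mulnBl mul1n leq_sub2l //.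
Qed.

Lemma card_not_hitting (I : finType) (F : I -> {set 'I_n * 'I_n}) :
  (forall i p, p \in F i -> p.1 != p.2) ->
  S ^ m * #|[set X in edge_sets_of_size n m |
     ~~ [forall i, (n ^ 2 <= S * #|F i|) ==> [exists p in F i, [set p.1; p.2] \in X]]]|
  <= #|I| * (S.-1 ^ m * 'C(N, m)).
Proof.
move=> offdiag.
pose miss i := [set X in edge_sets_of_size n m |
  (n ^ 2 <= S * #|F i|) && [disjoint X & edges_of (F i)]].
apply: (@leq_trans (S ^ m * #|\bigcup_i miss i|)).
  rewrite leq_mul // subset_leq_card //; apply/subsetP => X.
  rewrite inE => /andP[Xm /forallPn[i]]; rewrite negb_imply => /andP[dense /existsPn no].
  apply/bigcupP; exists i => //; rewrite inE Xm dense /=.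
  apply/pred0P => f /=; apply/negP => /andP[fX /imsetP[p pF fE]].
  by have := no p; rewrite pF -fE fX.
apply: (@leq_trans (S ^ m * \sum_i #|miss i|)).
  rewrite leq_mul //; elim/big_rec2: _ => [|i c A _ le]; first by rewrite cards0.
  by rewrite (leq_trans (leq_card_setU _ _).1) // leq_add2l.
rewrite big_distrr /= -[X in _ <= X](sum_nat_const I); apply: leq_sum => i _.
have [dense|sparse] := leqP (n ^ 2) (S * #|F i|).
  apply: leq_trans (card_missing (offdiag i) dense); rewrite leq_mul //.
  by rewrite subset_leq_card //; apply/subsetP => X; rewrite !inE => /and3P[-> _ ->].
rewrite (_ : miss i = set0) ?cards0 ?muln0 //; apply/setP => X.
by rewrite !inE leqNgt sparse andbF.
Qed.
End Hitting.

Lemma square_path_nth (T : eqType) (g : rel T) (s : seq T) x0 i d :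
  square_path g s -> 0 < d <= 2 -> i + d < size s -> g (nth x0 s i) (nth x0 s (i + d)).
Proof.
move=> + dr; elim: s i => [|x s IH] i //=.
case: i => [|i] /andP[/allP xs sqs] ids; last by apply: IH.
apply: xs; case: d dr ids {IH} => [|d] //= d2; rewrite !add0n ltnS => ds.
by rewrite -(@nth_take 2) // mem_nth // size_take_min leq_min d2.
Qed.

Lemma ham_cycle_of_square_path n (g : rel 'I_n) (H : {set {set 'I_n}}) s :
  uniq s -> size s = n -> square_path g (s ++ take 2 s) -> 1 < n ->
  (forall x y, g x y -> [set x; y] \in H) -> has_ham_cycle_power 2 H.
Proof.
move=> us szs sqs n1 gH.
have f_inj : injective (fun i : 'I_n => nth i s i).
  move=> i j; rewrite (set_nth_default i) ?szs // => /eqP.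
  by rewrite nth_uniq ?szs // => /eqP/val_inj.
apply/existsP; exists (perm f_inj); apply/forallP => i; apply/allP => j.
rewrite mem_iota addn2 => /andP[ij ji]; apply: gH; rewrite !permE.
have jn : j %% n < n by rewrite ltn_mod ltnW.
have -> : val (insubd i (j %% n)) = j %% n by rewrite insubdK.
have cyc k : k < n + 2 -> nth i (s ++ take 2 s) k = nth i s (k %% n).
  move=> kn; rewrite nth_cat szs; case: ltnP => nk; first by rewrite modn_small.
  have kn2 : k - n < 2 by rewrite ltn_subLR.
  rewrite nth_take // -{2}(subnK nk) modnDr modn_small //.
  exact: leq_trans kn2 n1.
rewrite (set_nth_default i _ (_ : j %% n < size s)) ?szs //.
have := @square_path_nth _ g _ i i (j - i) sqs; rewrite (subnKC (ltnW ij)) size_cat size_takel szs //.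
have jn2 : j < n + 2 by have := ltn_ord i; move: ji; clear; lia.
rewrite cyc; last by rewrite ltn_addr.
rewrite cyc // modn_small //; apply => //.
by move: ij ji; clear; lia.
Qed.

Lemma min_degree_le n (E : {set {set 'I_n}}) v : min_degree E <= degree E v.
Proof.
rewrite /min_degree; have := mem_index_enum v; elim: (index_enum _) => // w r IH.
rewrite inE big_cons geq_min => /orP[/eqP <-|/IH ->]; first by rewrite leqnn.
by rewrite orbT.
Qed.

Definition adj n (E : {set {set 'I_n}}) : rel 'I_n := [rel x y | [set x; y] \in E].

Lemma degree_le_nbhd n (E : {set {set 'I_n}}) v : E \subset complete_graph n ->
  degree E v <= #|nbhd (adj E) setT v|.
Proof.
move=> /subsetP EK; apply: (leq_trans _ (leq_imset_card (fun w => [set v; w]) _)).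
apply: subset_leq_card; apply/subsetP => f; rewrite inE => /andP[fE vf].
have f2 : #|f| == 2 by have := EK f fE; rewrite inE.
have [x [y [xy fxy]]] := cards2P f f2.
move: vf fE; rewrite fxy !inE => /orP[/eqP vx|/eqP vy] fE.
  by apply/imsetP; exists y; rewrite ?vx // !inE.
by apply/imsetP; exists x; rewrite ?vy ?inE /adj /= setUC.
Qed.

Lemma adj_sym n (E : {set {set 'I_n}}) : symmetric (adj E).
Proof. by move=> x y; rewrite /adj /= setUC. Qed.

Lemma adj_irr n (E : {set {set 'I_n}}) : E \subset complete_graph n -> irreflexive (adj E).
Proof.
by move=> /subsetP EK x; apply/negP => /EK; rewrite inE setUid cards1.
Qed.

(** Names for all the families of pairs that the deterministic part may ask for. *)
Definition code n S := (({set 'I_n} * {set 'I_n} * 'I_S.+1) +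
   ({set 'I_n} * {ffun 'I_n -> 'I_(#|'I_n|).+1} * 'I_S.+1))%type.

Definition decode n (e : rel 'I_n) S (c : code n S) : {set 'I_n * 'I_n} :=
  match c with
  | inl (W, Z, k) => rich_pairs e W Z k
  | inr (U, f, k) => slot_pairs e U (fun v => 2 ^ (#|'I_n| - f v)) k
  end.

Lemma card_set_type (T : finType) : #|{: {set T}}| = 2 ^ #|T|.
Proof.
rewrite -(cardsT T) -card_powerset; apply: eq_card => A.
by rewrite powersetE subsetT.
Qed.

Lemma card_code n S : #|{: code n S}| <= 2 * S.+1 * (4 * n.+1) ^ n.
Proof.
have mono a b : a <= b -> a ^ n <= b ^ n.
  by move=> ab; case: (n) => // k; rewrite leq_exp2r.
rewrite card_sum !card_prod !card_set_type card_ffun !card_ord -!mulnDl mulnC.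
rewrite (mulnC 2) -mulnA leq_mul // mul2n -addnn -!expnMn.
by apply: leq_add; apply: mono; [exact: leq_pmulr | exact: leq_mul].
Qed.

(** This is [card_not_hitting] for the families named by [code], combined with
    [square_cycle]. *)
Lemma few_failures q : 0 < q -> exists S n0, forall n m (G : {set {set 'I_n}}),
  n0 <= n -> G \subset complete_graph n ->
  (q + 2) * n <= 2 * q * min_degree G ->
  S.+1 ^ m * #|[set X in edge_sets_of_size n m | ~~ has_ham_cycle_power 2 (G :|: X)]|
   <= 2 * S.+2 * (4 * n.+1) ^ n * (S ^ m * #|edge_sets_of_size n m|).
Proof.
move=> q0; have [S [n0 cycle]] := square_cycle q0.
exists S, (n0 + 2) => n m G n_big GK deg.
rewrite card_edge_sets.
have offdiag (c : code n S.+1) p : p \in decode (adj G) c -> p.1 != p.2.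
  case: c => [[[W Z] k]|[[U f] k]] /=; rewrite inE; first by case/and4P.
  by case/existsP=> R /andP[/andP[_ /andP[]]].
apply: (leq_trans _ (leq_mul (card_code n S.+1) (leqnn _))).
apply: (leq_trans _ (card_not_hitting S.+1 m offdiag)).
rewrite leq_mul // subset_leq_card //; apply/subsetP => X; rewrite !inE.
case/andP=> -> /=; apply: contra => /forallP hitX.
have [||||||s [us szs sqs]] := cycle 'I_n (adj G) (adj X) (adj (G :|: X)) (adj_sym G) (adj_irr GK).
- by move=> x y; rewrite /adj /= inE => ->.
- by move=> x y; rewrite /adj /= inE orbC => ->.
- by rewrite card_ord (leq_trans _ n_big) // leq_addr.
- move=> x; rewrite card_ord (leq_trans deg) // leq_mul //.
  exact: leq_trans (min_degree_le G x) (degree_le_nbhd x GK).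
- move=> W Z k kS dense.
  have := hitX (inl (W, Z, inord k)); rewrite /= inordK; last by rewrite !ltnS ltnW.
  rewrite [X in X ^ 2 <= _]card_ord in dense; rewrite (leq_trans dense) /=; last by rewrite leq_mul.
  by case/existsP=> -[x y] /andP[xy xyX]; exists x, y.
- move=> U f k kS dense.
  have := hitX (inr (U, f, inord k)); rewrite /= inordK; last by rewrite !ltnS ltnW.
  rewrite [X in X ^ 2 <= _]card_ord in dense; rewrite (leq_trans dense) /=; last by rewrite leq_mul.
  by case/existsP=> p /andP[pF pX]; exists p.
apply: (ham_cycle_of_square_path us) sqs _ _ => //; first by rewrite szs card_ord.
by apply: leq_trans n_big; rewrite leq_addl.
Qed.

Import Order.TTheory GRing.Theory Num.Theory.
Import numFieldNormedType.Exports.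
Local Open Scope classical_set_scope.
Local Open Scope ring_scope.

(** * Asymptotics *)

Lemma ln_le_sub1 (R : realType) (x : R) : 0 < x -> ln x <= x - 1.
Proof. by move=> x0; rewrite -{1}[x](subrK 1) addrC le_ln1Dx //; lra. Qed.

(** With [y = n ^ (1 / 6)], the number of names is at most [exp (n * (7 + 6 y))] up to
    a constant, since [ln n = 6 ln y <= 6 y], while a given family is missed with
    probability at most [exp (- m / (S + 1))], where [m >= n * y ^ 2]. *)
Lemma union_bound_small (R : realType) (S : nat) (eps : R) : 0 < eps ->
  \forall n \near \oo, forall m : nat,
    (n%:R : R) `^ (4 / 3) * ln n%:R `^ (1 / 3) <= m%:R ->
    (2 * S.+2 * (4 * n.+1) ^ n * S ^ m)%:R <= eps * (S.+1 ^ m)%:R.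
Proof.
move=> eps0; near=> n => m mn.
pose T : R := S.+1%:R; pose y : R := n%:R `^ (1 / 6).
have T1 : 1 <= T by rewrite ler1n.
have nexp : expR 1 <= n%:R :> R by near: n; exact: nbhs_infty_ger.
have n1 : 1 <= n%:R :> R by rewrite (le_trans _ nexp) // -[leLHS]expR0 ler_expR.
have n0 : 0 < n%:R :> R by lra.
have y_big : 14 * T <= y.
  have : (14 * T) ^+ 6 <= n%:R by near: n; exact: nbhs_infty_ger.
  move=> big; rewrite /y -[leLHS]powRr1; last by lra.
  rewrite -[X in _ `^ X](@mulfV _ 6%:R) // powRrM powR_mulrn; last by lra.
  by rewrite div1r ge0_ler_powR ?nnegrE ?exprn_ge0 ?invr_ge0 //; lra.
have ly : ln n%:R <= 6 * y :> R.
  have -> : ln n%:R = 6 * ln y :> R by rewrite ln_powR; lra.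
  have := @ln_le_sub1 R y; lra.
have lnn : ln (4 * n.+1%:R) <= 7 + 6 * y :> R.
  apply: (@le_trans _ _ (ln (8 * n%:R))).
    by rewrite ler_ln ?posrE -?natr1; lra.
  rewrite lnM ?posrE //; have := @ln_le_sub1 R 8; lra.
have mny : n%:R * y ^+ 2 <= m%:R.
  apply: le_trans mn.
  have -> : n%:R `^ (4 / 3) = n%:R * y ^+ 2 :> R.
    rewrite -powR_mulrn ?powR_ge0 // -powRrM -{2}[n%:R]powRr1 ?ltW // -powRD.
      by congr (_ `^ _); field.
    by apply/implyP => _; rewrite gt_eqF.
  rewrite ler_peMr ?mulr_ge0 ?exprn_ge0 ?powR_ge0 //.
  have ln1 : 1 <= ln n%:R :> R by rewrite -[leLHS]expRK ler_ln ?posrE ?expR_gt0.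
  have third : 0 <= 1 / 3 :> R by lra.
  have := ge0_ler_powR third _ _ ln1; rewrite powR1; apply; rewrite nnegrE //; lra.
have ce : (2 * S.+2)%:R <= eps * (1 + n%:R).
  rewrite mulrC -ler_pdivrMr // (@le_trans _ _ n%:R) //; last by lra.
  by near: n; exact: nbhs_infty_ger.
have T0 : 0 < T by lra.
have exponent : n%:R * ln (4 * n.+1%:R) - m%:R / T <= - n%:R.
  have y2T : 14 * y <= y ^+ 2 / T.
    by rewrite ler_pdivlMr // expr2 mulrAC ler_wpM2r //; lra.
  have mT : n%:R * (y ^+ 2 / T) <= m%:R / T by rewrite mulrA ler_wpM2r // invr_ge0 ltW.
  have : n%:R * ln (4 * n.+1%:R) <= n%:R * (7 + 6 * y) by rewrite ler_wpM2l // ltW.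
  have : n%:R * (14 * y) <= n%:R * (y ^+ 2 / T) by rewrite ler_wpM2l // ltW.
  have ny : n%:R <= n%:R * y by rewrite ler_peMr //; lra.
  move: mT ny; move: (n%:R * (y ^+ 2 / T)) (m%:R / T) (n%:R * ln _) => a b c.
  rewrite mulrDr !(mulrCA n%:R); move: (n%:R * y) => d.
  by lra.
have An : (4 * n.+1%:R) ^+ n = expR (n%:R * ln (4 * n.+1%:R)) :> R.
  by rewrite expRM_natl lnK // posrE mulr_gt0 // ltr0n.
have Sm : (S%:R : R) ^+ m <= T ^+ m * expR (- (m%:R / T)).
  rewrite -mulrN expRM_natl -exprMn lerXn2r ?nnegrE ?mulr_ge0 ?ler0n ?expR_ge0 ?(ltW T0) //.
  have le : T * (1 - T^-1) <= T * expR (- T^-1) by rewrite ler_pM2l // expR_ge1Dx.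
  rewrite mulrBr mulfV ?gt_eqF // in le.
  by apply: le_trans le; rewrite /T -natr1; lra.
rewrite !(natrM, natrX) -natrM An.
apply: (@le_trans _ _ (eps * (1 + n%:R) * expR (n%:R * ln (4 * n.+1%:R)) *
    (T ^+ m * expR (- (m%:R / T))))).
  by rewrite ler_pM ?mulr_ge0 ?expR_ge0 ?exprn_ge0 // ler_wpM2r ?expR_ge0.
rewrite mulrACA -!mulrA ler_wpM2l ?(ltW eps0) // mulrCA ler_piMr ?exprn_ge0 ?(ltW T0) //.
rewrite -expRD.
apply: (@le_trans _ _ (expR n%:R * expR (- n%:R))).
  by rewrite ler_pM ?expR_ge0 ?expR_ge1Dx ?ler_expR //; lra.
by rewrite -expRD subrr expR0.
Unshelve. all: by end_near.
Qed.

Theorem theorem1 (R : realType) (alpha : R) (halpha : 1 / 2 < alpha) :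
  exists2 K : R, 0 < K &
    forall eps : R, 0 < eps ->
      \forall n \near \oo,
        forall (G : {set {set 'I_n}}) (m : nat),
          G \subset complete_graph n ->
          alpha * n%:R <= (min_degree G)%:R ->
          K * n%:R `^ (4 / 3) * ln n%:R `^ (1 / 3) <= m%:R ->
          (m <= 'C(n, 2))%N ->
          1 - eps <= prob_edge_set R m
                       (fun X => has_ham_cycle_power 2 (G :|: X)).
Proof.
(* With this q, alpha is at least 1 / 2 + 1 / q. *)
pose q := (Num.bound (alpha - 1 / 2)^-1).
have a0 : 0 < alpha - 1 / 2 by lra.
have qa : 1 <= q%:R * (alpha - 1 / 2).
  rewrite -ler_pdivrMr // (div1r (alpha - 1 / 2)); apply/ltW/archi_boundP.
  by rewrite invr_ge0 ltW.
have q0 : (0 < q)%N by rewrite lt0n; apply: contraTneq qa => ->; rewrite mul0r; lra.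
have [S [n0 few]] := few_failures q0.
(* The union bound only uses that m exceeds n log n by a power of n. *)
exists 1 => // eps eps0; near=> n => G m GK deg mn mN; rewrite mul1r in mn.
have degq : ((q + 2) * n <= 2 * q * min_degree G)%N.
  rewrite -(ler_nat R) !natrM natrD.
  have d2 : 2 * q%:R * (alpha * n%:R) <= 2 * q%:R * (min_degree G)%:R :> R.
    by rewrite ler_wpM2l // mulr_ge0 // ler0n.
  apply: le_trans d2; rewrite mulrA ler_wpM2r ?ler0n //; lra.
have n_big : (n0 <= n)%N by near: n; exact: nbhs_infty_ge.
have small : (2 * S.+2 * (4 * n.+1) ^ n * S ^ m)%:R <= eps * (S.+1 ^ m)%:R :> R.
  by move: mn; move: {few deg mN} m; near: n; exact: union_bound_small.
have {few} := few n m G n_big GK degq.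
rewrite /prob_edge_set.
set A := edge_sets_of_size n m; set B := [set X in A | ~~ _].
set C := [set X in A | _] => few.
have A0 : (0 < #|A|)%N by rewrite /A card_edge_sets bin_gt0.
clearbody A.
have ABC : (#|C| + #|B|)%N = #|A|.
  rewrite -(cardsID C A); congr (_ + _)%N; apply: eq_card => X.
    by rewrite !inE; case: (X \in A).
  by rewrite !inE; case: (X \in A); rewrite ?andbT.
have Bsmall : #|B|%:R <= eps * #|A|%:R :> R.
  have Tm0 : 0 < (S.+1 ^ m)%:R :> R by rewrite ltr0n expn_gt0.
  rewrite -(ler_pM2l Tm0) mulrA -natrM (mulrC _ eps).
  apply: (@le_trans _ _ ((2 * S.+2 * (4 * n.+1) ^ n * S ^ m)%:R * #|A|%:R)).
    by rewrite -natrM ler_nat -[leqRHS]mulnA.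
  by rewrite ler_wpM2r ?ler0n.
rewrite ler_pdivlMr ?ltr0n // -ABC natrD; rewrite -ABC natrD in Bsmall; lra.
Unshelve. all: by end_near.
Qed.
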